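(* Let $n\ge2$, $k=\lfloor\frac{n+1}{2}\rfloor$, $N=k(n-1)$, and let $M=N$ if $n$ is even and $M=N-n+1$ if $n$ is odd. The functions on $SL_n$ $$\theta_i(X)=\det X_{[n-i+1,n]}^{[n-i+1,n]},\quad i\in[n-1];$$ $$\varphi_i(X)=\det U(X,X)_{[N-i+1,N]}^{[k(n+1)-i+1,\,k(n+1)]},\quad i\in[N];$$ $$\psi_i(X)=\det U(X,X)_{[N-i+1,N]}^{[k(n+1)-i+2,\,k(n+1)+1]},\quad i\in[M],$$ form a log-canonical family with respect to the Cremmer--Gervais bracket on $SL_n$; that is, for any two functions $f,g$ in this family, $\{f,g\}=\omega_{f,g}\,fg$ for a constant $\omega_{f,g}$.
   Context: Notation: $[a,b]=\{a,\dots,b\}$, $[m]=[1,m]$; $A_I^J$ is the submatrix of $A$ with rows $I$ and columns $J$ (omitted index set: all rows/columns). For $n\times n$ matrices $X,Y$ put $\mathcal X=[X_{[2,n]}\ \ 0]$ and $\mathcal Y=[0\ \ Y_{[1,n-1]}]$ (both $(n-1)\times(n+1)$, with one zero column appended on the right, respectively on the left), and let $U(X,Y)$ be the $k(n-1)\times(k+1)(n+1)$ matrix $$U(X,Y)=\begin{bmatrix}\mathcal Y&\mathcal X&0&\cdots&0\\0&\mathcal Y&\mathcal X&0&\cdots\\0&\ddots&\ddots&\ddots&0\\0&\cdots&0&\mathcal Y&\mathcal X\end{bmatrix}$$ with $k$ block rows and $k+1$ block columns. Cremmer--Gervais bracket. Let $\langle A,B\rangle=\mathrm{Tr}(AB)$;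 $\nabla f$ is the gradient with respect to this form; $A_{>0}$ is the strictly upper triangular part of $A$ and $A_{\le0}$ its lower triangular part including the diagonal; $S=e_{12}+\dots+e_{n-1,n}$, $D_n=\mathrm{diag}(1,\dots,n)$, $\gamma_+(A)=SAS^T$, $\gamma_-(A)=S^TAS$, $\mathbf 1$ the identity matrix. The bracket on $n\times n$ matrices is $$\{f_1,f_2\}(X)=\langle R_+(\nabla f_1(X)X),\nabla f_2(X)X\rangle-\langle R_+(X\nabla f_1(X)),X\nabla f_2(X)\rangle,$$ $$R_+(\eta)=\tfrac{1}{1-\gamma_+}\eta_{>0}-\tfrac{\gamma_-}{1-\gamma_-}\eta_{\le0}+\tfrac{n-1}{2n}\mathrm{Tr}(\eta)\mathbf 1+\tfrac1n\big(\mathrm{Tr}(\eta)D_n-\mathrm{Tr}(D_n\eta)\mathbf 1\big).$$ The determinant is a Casimir function of it, and the Cremmer--Gervais bracket on $SL_n$ is its restriction to $SL_n$. *)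

(* Defs.v *)
From mathcomp Require Import all_boot all_order all_algebra.
From mathcomp.multinomials Require Import mpoly.

Set Implicit Arguments.
Unset Strict Implicit.
Unset Printing Implicit Defensive.

Import GRing.Theory.
Local Open Scope ring_scope.

Section Submatrices.

Variable R : pzRingType.

(* Entry of A at the 0-based position (i, j), read as 0 outside A; the
   submatrices below are only taken at positions inside A. *)
Definition entry m n (A : 'M[R]_(m, n)) (i j : nat) : R :=
  if (insub i, insub j) is (Some r, Some s) then A r s else 0.

(* subblock A a b : 'M_(p, q) is A_{[a, a+p-1]}^{[b, b+q-1]}, with a, b >= 1
   counted from 1 as in the mathematical text. *)
Definition subblock m n (A : 'M[R]_(m, n)) (a b : nat) p q : 'M[R]_(p, q) :=
  \matrix_(r < p, s < q) entry A (a.-1 + r) (b.-1 + s).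

End Submatrices.

Arguments subblock {R m n} A a b {p q}.

Section MatrixU.

Variables (R : pzRingType) (n : nat).

(* [X_{[2,n]} 0] *)
Definition calX (X : 'M[R]_n) : 'M[R]_(n.-1, n.+1) :=
  castmx (erefl n.-1, addn1 n)
    (row_mx (subblock X 2 1 : 'M_(n.-1, n)) (0 : 'M_(n.-1, 1))).

(* [0 Y_{[1,n-1]}] *)
Definition calY (Y : 'M[R]_n) : 'M[R]_(n.-1, n.+1) :=
  castmx (erefl n.-1, add1n n)
    (row_mx (0 : 'M_(n.-1, 1)) (subblock Y 1 1 : 'M_(n.-1, n))).

Definition matU (k : nat) (X Y : 'M[R]_n) :=
  \mxblock_(r < k, c < k.+1)
    (if c == r :> nat then calY Y
     else if c == r.+1 :> nat then calX X
     else 0 : 'M[R]_(n.-1, n.+1)).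

End MatrixU.

(* Polynomial functions on n x n matrices are elements of {mpoly F[n * n]}: the
   coordinate function x_ij is the variable of index mxvec_index i j. *)
Section PolynomialFunctions.

Variables (F : fieldType) (n : nat).
Implicit Types (f g : {mpoly F[n * n]}) (X : 'M[F]_n).

Definition genmat : 'M[{mpoly F[n * n]}]_n :=
  \matrix_(i, j) 'X_(mxvec_index i j).

Definition evalf f X : F := f.@[fun v => mxvec X 0 v].

(* The gradient for <A, B> = Tr(AB), i.e. d f(X)(V) = Tr(grad f X *m V); the
   (i, j) entry is therefore the derivative with respect to x_ji. *)
Definition grad f X : 'M[F]_n :=
  \matrix_(i, j) evalf f^`M(mxvec_index j i) X.

End PolynomialFunctions.

Section CremmerGervais.

Variables (F : fieldType) (n : nat).
Implicit Types (f g : {mpoly F[n * n]}) (X A eta : 'M[F]_n).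

Definition trform A B : F := \tr (A *m B).

Definition upper_part A : 'M[F]_n :=
  \matrix_(i, j) (if (i < j)%N then A i j else 0).

Definition lower_part A : 'M[F]_n :=
  \matrix_(i, j) (if (j <= i)%N then A i j else 0).

Definition shift_mx : 'M[F]_n := \matrix_(i, j) (j == i.+1 :> nat)%:R.

Definition D_mx : 'M[F]_n := diag_mx (\row_j (j.+1)%:R).

Definition gamma_plus A : 'M[F]_n := shift_mx *m A *m shift_mx^T.
Definition gamma_minus A : 'M[F]_n := shift_mx^T *m A *m shift_mx.

(* 1 / (1 - gamma) as an endomorphism of 'M_n; gamma_plus and gamma_minus are
   linear and nilpotent, so the inverse below is two-sided for both. *)
Definition resolvent (gamma : 'M[F]_n -> 'M[F]_n) : 'End('M[F]_n) :=
  ((\1 - linfun gamma)^-1)%VF.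

Definition R_plus eta : 'M[F]_n :=
  resolvent gamma_plus (upper_part eta)
  - gamma_minus (resolvent gamma_minus (lower_part eta))
  + (n.-1%:R / (2 * n)%:R * \tr eta)%:M
  + n%:R^-1 *: (\tr eta *: D_mx - (\tr (D_mx *m eta))%:M).

Definition CG_bracket f g X : F :=
  trform (R_plus (grad f X *m X)) (grad g X *m X)
  - trform (R_plus (X *m grad f X)) (X *m grad g X).

(* A function on SL_n is given by a polynomial on n x n matrices; the bracket
   on SL_n is the restriction of CG_bracket to the matrices of determinant 1. *)
Definition log_canonical_SL (family : {mpoly F[n * n]} -> Prop) : Prop :=
  forall f g, family f -> family g ->
  exists omega : F, forall X, \det X = 1 ->
    CG_bracket f g X = omega * (evalf f X * evalf g X).

Definition CG_k : nat := n.+1./2.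
Definition CG_N : nat := CG_k * n.-1.
Definition CG_M : nat := if odd n then (CG_N - n).+1 else CG_N.

Definition genU := matU CG_k (genmat F n) (genmat F n).

Definition theta (i : nat) : {mpoly F[n * n]} :=
  \det (subblock (genmat F n) (n - i).+1 (n - i).+1 : 'M_i).

Definition phi (i : nat) : {mpoly F[n * n]} :=
  \det (subblock genU (CG_N - i).+1 (CG_k * n.+1 - i).+1 : 'M_i).

Definition psi (i : nat) : {mpoly F[n * n]} :=
  \det (subblock genU (CG_N - i).+1 (CG_k * n.+1 - i).+2 : 'M_i).

Definition CG_family f : Prop :=
  [\/ exists2 i : nat, (1 <= i <= n.-1)%N & f = theta i,
      exists2 i : nat, (1 <= i <= CG_N)%N & f = phi i
    | exists2 i : nat, (1 <= i <= CG_M)%N & f = psi i].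

End CremmerGervais.

(* Main.v *)
From HB Require Import structures.
Require Import Defs.
From mathcomp Require Import all_boot all_order all_algebra perm.
From mathcomp Require Import ring zify.
From mathcomp.multinomials Require Import mpoly.

(* Write [a = grad f * X] and [b = X * grad f], and for a minor [f] of [U(X,Y)]
   split the gradient at [Y = X] into the parts coming from [X] and from [Y].
   Then [a^X + gamma_-(a^Y)] and its analogue for [b] are sums of diagonal blocks
   of [adj U] and [U adj], hence triangular off a single block row or column and
   with diagonal a constant multiple of [f].  Since [a^X + a^Y] differs from them
   by [(1 - gamma) a^Y], the resolvents in [R_+] cancel, and the bracket of two
   functions of the family is a constant multiple of their product plus three
   traces.  For two minors of [U], these traces are grouped by the relative block
   shift [t] of the second minor along the block Toeplitz matrix [U]; for each [t]
   they add up to a sum of entries of [U adj_f U] against [adj_g], which is a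
   constant times [f g] as soon as the first minor is the larger one.  Skew
   symmetry covers the other order, and for the principal minors [theta_i] the
   three traces cancel. *)

(** A trace over n x n matrices sees only the position of a row or column of [U] inside its block,
    not the number of the block. Sorting coincidences of positions by the difference [t] of block
    numbers restores full row and column indices, at the price of one pair of windows of [U] for
    each [t]. The windows share their lower right corner, at the end of a block, up to one extra
    column for [psi]. Moving right or down inside a block thus stays in the window (the extra column
    is treated apart), where [adj U] and [U adj] are [f] times the identity; hence the
    triangularity. Moving left or up may leave the window through its incomplete first block, and
    the entries met there are what makes the three traces nontrivial. Skew symmetry is not visible
    on [R_plus]: its sum with its adjoint is the identity plus a multiple of the product of traces.
    The corresponding form takes equal values on left and right gradients, so it cancels in the
    bracket. *)

Set Implicit Arguments.
Unset Strict Implicit.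
Unset Printing Implicit Defensive.

Import GRing.Theory.
Local Open Scope ring_scope.

(* Evaluates the 0/1 coefficients [b%:R] left by a case analysis on [b]. *)
Ltac bring :=
  try change (nat_of_bool true) with 1%N;
  try change (nat_of_bool false) with 0%N; ring.

(** * Minors of a block Toeplitz band matrix *)

Section Window.

Variables (R : comNzRingType) (u : nat -> nat -> R) (p q i : nat).

Definition window : 'M[R]_i := \matrix_(r, s) u (p + r) (q + s).

Local Notation G := (\adj window).
Local Notation f := (\det window).

Definition adjU (s : 'I_i) (k : nat) : R := \sum_(r < i) G s r * u (p + r) k.
Definition Uadj (h : nat) (r : 'I_i) : R := \sum_(s < i) u h (q + s) * G s r.
(** By the bordering formula, [f * u h k - UadjU h k] is the minor obtained by adding row [h] and
    column [k] at the end of the window. *)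
Definition UadjU (h k : nat) : R := \sum_(s < i) u h (q + s) * adjU s k.

Lemma UadjUE h k : UadjU h k = \sum_(r < i) Uadj h r * u (p + r) k.
Proof.
rewrite /UadjU; under eq_bigr do rewrite mulr_sumr.
rewrite exchange_big; apply: eq_bigr => r _; rewrite mulr_suml.
by apply: eq_bigr => s _; rewrite mulrA.
Qed.

Lemma adjU_window (s s' : 'I_i) : adjU s (q + s') = f * (s == s')%:R.
Proof.
have /matrixP/(_ s s') := mul_adj_mx window; rewrite !mxE mulr_natr => <-.
by apply: eq_bigr => r _; rewrite [X in _ = _ * X]mxE.
Qed.

Lemma Uadj_window (r r' : 'I_i) : Uadj (p + r) r' = f * (r == r')%:R.
Proof.
have /matrixP/(_ r r') := mul_mx_adj window; rewrite !mxE mulr_natr => <-.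
by apply: eq_bigr => s _; rewrite [X in _ = X * _]mxE.
Qed.

Lemma sum_delta (T : finType) (x : T) (F : T -> R) :
  \sum_y (y == x)%:R * F y = F x.
Proof.
rewrite (bigD1 x) //= eqxx mul1r big1 ?addr0 // => y /negPf->.
by rewrite mul0r.
Qed.

Lemma UadjU_col h (s : 'I_i) : UadjU h (q + s) = f * u h (q + s).
Proof.
rewrite /UadjU -[RHS](sum_delta s (fun s' => f * u h (q + s'))).
by apply: eq_bigr => s' _; rewrite adjU_window; bring.
Qed.

Lemma UadjU_row (r : 'I_i) k : UadjU (p + r) k = f * u (p + r) k.
Proof.
rewrite UadjUE -[RHS](sum_delta r (fun r' => f * u (p + r') k)).
by apply: eq_bigr => r' _; rewrite Uadj_window eq_sym; bring.
Qed.

End Window.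

Arguments adjU {R} u p q {i} s k.
Arguments Uadj {R} u p q {i} h r.
Arguments UadjU {R} u p q i h k.

Section Band.

Variables (R : comNzRingType) (m w : nat) (u : nat -> nat -> R).

Local Notation rb h := (h %/ m)%N.
Local Notation cb k := (k %/ w)%N.

Definition bandX (h k : nat) : R := (cb k == (rb h).+1)%:R * u h k.
Definition bandY (h k : nat) : R := (cb k == rb h)%:R * u h k.

Hypothesis u_band : forall h k,
  cb k != rb h -> cb k != (rb h).+1 -> u h k = 0.

Section LocalTerms.

Variables (p q i : nat).

Local Notation G := (\adj (window u p q i)).
Local Notation f := (\det (window u p q i)).

(** The window ends with a block: rows below it vanish on its columns and further left, and to the
    right of it no row down to its last one meets a [Y] block. *)
Hypothesis u_below : forall h k, (p + i <= h)%N -> (k < q + i)%N -> u h k = 0.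
Hypothesis u_right : forall h k, (h < p + i)%N -> (q + i <= k)%N ->
  (cb k) <> (rb h).

(* Below, the coefficients of the entries of [adj_g] in the three traces that make
   up [bracket_rest], for one relative shift of the two minors. *)
Definition term_lower (h k : nat) : R :=
  \sum_(s < i) (cb (q + s) == cb k)%:R * (k <= q + s)%:R *
    adjU u p q s k * bandX h (q + s).

Definition term_diag (h k : nat) : R :=
  \sum_(r < i) (p + r == h)%:R * (f * bandX h k).

Definition term_upper (h k : nat) : R :=
  \sum_(r < i) (rb h == rb (p + r))%:R * (h < p + r)%:R *
    Uadj u p q h r * bandY (p + r) k.

Lemma UadjU_below h k : (p + i <= h)%N -> UadjU u p q i h k = 0.
Proof.
move=> le_h; rewrite /UadjU big1 // => s _.
by rewrite u_below ?mul0r // ltn_add2l.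
Qed.

Lemma term_lower_right h k : (q + i <= k)%N -> term_lower h k = 0.
Proof.
move=> le_k; rewrite /term_lower big1 // => s _.
rewrite (_ : (k <= q + s)%N = false) ?mulr0 ?mul0r //.
by have := ltn_ord s; lia.
Qed.

Lemma term_lower_mid h (s : 'I_i) : term_lower h (q + s) = f * bandX h (q + s).
Proof.
rewrite /term_lower -[RHS](sum_delta s (fun s' => f * bandX h (q + s'))).
apply: eq_bigr => s' _; rewrite adjU_window.
by case: (eqVneq s') => [->|_]; rewrite ?eqxx ?leqnn; bring.
Qed.

(** The order mask holds for every [s], and the block mask becomes a condition on [k] alone: a
    window column beyond block [(rb h).+1] has no entry in row [h]. *)
Lemma term_lower_left h k : (k < q)%N ->
  term_lower h k = (cb k == (rb h).+1)%:R * UadjU u p q i h k.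
Proof.
move=> lt_k; rewrite /term_lower /UadjU mulr_sumr; apply: eq_bigr => s _.
have le_c : (cb k <= cb (q + s))%N by rewrite leq_div2r; lia.
rewrite (_ : (k <= q + s)%N = true); last by lia.
rewrite /bandX.
have [ckE|ckN] := eqVneq (cb k) (rb h).+1; last first.
  case: eqVneq => [->|_]; rewrite ?(negPf ckN); bring.
have [csE|csN] := eqVneq (cb (q + s)) (cb k).
  by rewrite csE ckE eqxx; bring.
by rewrite u_band; [bring | lia | rewrite -ckE].
Qed.

Lemma term_upper_below h k : (p + i <= h)%N -> term_upper h k = 0.
Proof.
move=> le_h; rewrite /term_upper big1 // => r _.
rewrite (_ : (h < p + r)%N = false) ?mulr0 ?mul0r //.
by have := ltn_ord r; lia.
Qed.

Lemma term_upper_mid (r : 'I_i) k : term_upper (p + r) k = 0.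
Proof.
rewrite /term_upper big1 // => r' _; rewrite Uadj_window.
by case: (eqVneq r) => [->|_]; rewrite ?ltnn; bring.
Qed.

Lemma term_upper_above h k : (h < p)%N ->
  term_upper h k = (cb k == rb h)%:R * UadjU u p q i h k.
Proof.
move=> lt_h; rewrite /term_upper UadjUE mulr_sumr; apply: eq_bigr => r _.
have le_r : (rb h <= rb (p + r))%N by rewrite leq_div2r; lia.
rewrite (_ : (h < p + r)%N = true); last by lia.
rewrite /bandY.
have [ckE|ckN] := eqVneq (cb k) (rb h); last first.
  case: (eqVneq (rb h)) => [<-|_]; rewrite ?(negPf ckN); bring.
have [rE|rN] := eqVneq (rb h) (rb (p + r)).
  by rewrite ckE rE eqxx; bring.
by rewrite u_band ?ckE //; [bring | lia].
Qed.

Lemma term_diag_in (r : 'I_i) k : term_diag (p + r) k = f * bandX (p + r) k.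
Proof.
rewrite /term_diag -[RHS](sum_delta r (fun r' => f * bandX (p + r) k)).
by apply: eq_bigr => r' _; rewrite eqn_add2l.
Qed.

Lemma term_diag_out h k : (h < p)%N || (p + i <= h)%N -> term_diag h k = 0.
Proof.
move=> out_h; rewrite /term_diag big1 // => r _.
rewrite (_ : (p + r == h)%N = false) ?mul0r //.
by have := ltn_ord r; lia.
Qed.

(* The three masked products combine into [U adj U] with the masks gone: off
   the rows and columns of the window only the band structure of [U] is used. *)
Lemma terms_collapse h k :
  term_diag h k - term_lower h k - term_upper h k =
  ((q + i <= k)%:R - (h < p)%:R) * UadjU u p q i h k.
Proof.
have [le_h|lt_h] := leqP (p + i) h.
  rewrite term_diag_out ?le_h ?orbT // term_upper_below // UadjU_below //.
  have [le_k|lt_k] := leqP (q + i) k; first by rewrite term_lower_right //; bring.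
  have [lt_kq|le_qk] := ltnP k q.
    by rewrite term_lower_left // UadjU_below //; bring.
  have ks : (k - q < i)%N by lia.
  rewrite -(subnKC le_qk) (term_lower_mid h (Ordinal ks)) /=.
  by rewrite /bandX subnKC // u_below //; bring.
have [lt_hp|le_ph] := ltnP h p; last first.
  have hr : (h - p < i)%N by lia.
  rewrite -(subnKC le_ph); pose r := Ordinal hr.
  rewrite (term_diag_in r) (term_upper_mid r) (UadjU_row _ _ _ r) /= subnKC //.
  have [le_k|lt_k] := leqP (q + i) k.
    rewrite term_lower_right //.
    rewrite /bandX; have [_|neX] := eqVneq (cb k); first by bring.
    by rewrite u_band //; [bring | apply/eqP/u_right].
  have [lt_kq|le_qk] := ltnP k q.
    by rewrite term_lower_left // -(subnKC le_ph) (UadjU_row _ _ _ r) /bandX; bring.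
  have ks : (k - q < i)%N by lia.
  by rewrite -(subnKC le_qk) (term_lower_mid h (Ordinal ks)) /=; bring.
rewrite term_diag_out ?lt_hp // term_upper_above //.
have [le_k|lt_k] := leqP (q + i) k.
  rewrite term_lower_right // UadjUE.
  suff -> : (cb k == rb h)%:R * (\sum_(r < i) Uadj u p q h r * u (p + r) k)
    = 0 by bring.
  rewrite mulr_sumr big1 // => r _.
  have le_r : (rb h <= rb (p + r))%N by rewrite leq_div2r; lia.
  case: eqVneq => [ck|_]; last by bring.
  rewrite u_band; [bring | | by lia].
  by apply/eqP/u_right; have := ltn_ord r; lia.
have [lt_kq|le_qk] := ltnP k q; last first.
  have ks : (k - q < i)%N by lia.
  rewrite -(subnKC le_qk) (term_lower_mid h (Ordinal ks)).
  rewrite (UadjU_col _ _ _ h (Ordinal ks)) /= subnKC // /bandX.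
  have [ckX|ckX] := eqVneq (cb k) (rb h).+1.
    by rewrite (_ : (_ == (rb h)) = false); [bring | lia].
  have [ckY|ckY] := eqVneq (cb k) (rb h); first by bring.
  by rewrite u_band //; bring.
rewrite term_lower_left //.
have [ckX|ckX] := eqVneq (cb k) (rb h).+1.
  by rewrite (_ : (_ == (rb h)) = false); [bring | lia].
have [ckY|ckY] := eqVneq (cb k) (rb h); first by bring.
(* Block [cb k] is neither [rb h] nor [(rb h).+1]. A window column met by row [h] forces
   [cb k < rb h], and then column [k] vanishes on every window row. *)
suff -> : UadjU u p q i h k = 0 by bring.
rewrite /UadjU big1 // => s _.
have lek : (cb k <= cb (q + s))%N by rewrite leq_div2r; lia.
have [?|hN] := leqP (cb (q + s)) (rb h).+1; last first.
  by rewrite u_band ?mul0r //; lia.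
rewrite /adjU big1 ?mulr0 // => r _.
have ler : (rb h <= rb (p + r))%N by rewrite leq_div2r; lia.
by rewrite [u _ k]u_band ?mulr0 //; lia.
Qed.

End LocalTerms.

End Band.

(** * Two windows of the same band matrix *)

Section WindowPair.

Variables (R : comNzRingType) (m w : nat) (u : nat -> nat -> R).

Hypothesis u_band : forall h k,
  (k %/ w != h %/ m)%N -> (k %/ w != (h %/ m).+1)%N -> u h k = 0.

Variables (p q i p' q' i' : nat).

Local Notation f := (\det (window u p q i)).
Local Notation g := (\det (window u p' q' i')).
Local Notation H := (\adj (window u p' q' i')).

Hypothesis u_below : forall h k, (p + i <= h)%N -> (k < q + i)%N -> u h k = 0.
Hypothesis u_right : forall h k, (h < p + i)%N -> (q + i <= k)%N ->
  (k %/ w)%N <> (h %/ m)%N.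
Hypothesis u_below' :
  forall h k, (p' + i' <= h)%N -> (k < q' + i')%N -> u h k = 0.
Hypothesis le_pq : (q' + i' <= q + i)%N || (p <= p')%N.

(** The two counts come from the diagonals of [U adj_g] and [adj_g U], cut off at the lower right
    corner of the first window. *)
Definition pair_coef : R :=
  if (q' + i' <= q + i)%N then 0
  else \sum_(r < i') (p' + r < p + i)%:R - \sum_(s < i') (q' + s < q + i)%:R.

(** Row [p + r] lies below row [p' + r']: it is a different row of the second window, or it is below
    that window, where [u] vanishes on its columns. *)
Lemma Uadj_outside (r : 'I_i) (r' : 'I_i') :
  (p' + r' < p)%N -> Uadj u p' q' (p + r) r' = 0.
Proof.
move=> lt_r'p; have [le_r|lt_r] := leqP (p' + i') (p + r).
  by rewrite /Uadj big1 // => s _; rewrite u_below' ?mul0r // ltn_add2l.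
have lt_r'' : (p + r - p' < i')%N by lia.
have -> : (p + r = p' + Ordinal lt_r'')%N by rewrite /=; lia.
rewrite Uadj_window -val_eqE /= (_ : (_ == _) = false); first by bring.
by apply/eqP; lia.
Qed.

Lemma sum_above :
  \sum_(s' < i') \sum_(r' < i') H s' r' *
    ((p' + r' < p)%:R * UadjU u p q i (p' + r') (q' + s')) = 0.
Proof.
rewrite exchange_big big1 // => r' _.
have [lt_p|_] := ltnP (p' + r') p; last first.
  by rewrite big1 // => s' _; bring.
(* Contracting [u] with [H] first gives [U adj_g] at the rows of the first window. *)
transitivity (\sum_(r < i) Uadj u p q (p' + r') r * Uadj u p' q' (p + r) r').
  under eq_bigr do rewrite UadjUE mul1r mulr_sumr.
  rewrite exchange_big; apply: eq_bigr => r _; rewrite mulr_sumr.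
  by apply: eq_bigr => s' _; ring.
by rewrite big1 // => r _; rewrite Uadj_outside ?mulr0.
Qed.

Lemma sum_right :
  \sum_(s' < i') \sum_(r' < i') H s' r' *
    ((q + i <= q' + s')%:R * UadjU u p q i (p' + r') (q' + s')) =
  pair_coef * (f * g).
Proof.
rewrite /pair_coef; case: leqP => [le_e|lt_e].
  rewrite mul0r big1 // => s' _; rewrite big1 // => r' _.
  by rewrite (_ : (q + i <= q' + s')%N = false); [bring | have := ltn_ord s'; lia].
have le_p : (p <= p')%N by lia.
(* As [p <= p'], each row [p' + r'] is inside the first window, where [UadjU] is [f * u], or below
   it, where [UadjU] vanishes. This turns the mask into a row mask minus a column mask. *)
transitivity (\sum_(r' < i') \sum_(s' < i') f *
    ((p' + r' < p + i)%:R * (u (p' + r') (q' + s') * H s' r') -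
     (q' + s' < q + i)%:R * (H s' r' * u (p' + r') (q' + s')))).
  rewrite exchange_big; apply: eq_bigr => r' _; apply: eq_bigr => s' _.
  have [le_r|lt_r] := leqP (p + i) (p' + r').
    rewrite UadjU_below //; case: ltnP => [lt_s|_]; last by bring.
    by rewrite u_below //; bring.
  have lt_r0 : (p' + r' - p < i)%N by lia.
  have -> : (p' + r' = p + Ordinal lt_r0)%N by rewrite /=; lia.
  by rewrite UadjU_row; case: ltnP => _; bring.
transitivity (f * (\sum_(r' < i') (p' + r' < p + i)%:R * Uadj u p' q' (p' + r') r' -
   \sum_(s' < i') (q' + s' < q + i)%:R * adjU u p' q' s' (q' + s'))).
  rewrite mulrBr !mulr_sumr.
  rewrite [X in _ = _ - X](eq_bigr (fun s' : 'I_i' => \sum_(r' < i') f *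
     ((q' + s' < q + i)%:R * (H s' r' * u (p' + r') (q' + s'))))); last first.
    by move=> s' _; rewrite /adjU !mulr_sumr.
  rewrite [X in _ = _ - X]exchange_big -sumrB.
  apply: eq_bigr => r' _; rewrite /Uadj !mulr_sumr -sumrB.
  by apply: eq_bigr => s' _; rewrite mulrBr.
under eq_bigr do rewrite Uadj_window eqxx mulr1.
under [X in _ - X]eq_bigr do rewrite adjU_window eqxx mulr1.
by rewrite -!mulr_suml; ring.
Qed.

Lemma sum_terms :
  \sum_(s' < i') \sum_(r' < i') H s' r' *
    (term_diag m w u p q i (p' + r') (q' + s')
     - term_lower m w u p q i (p' + r') (q' + s')
     - term_upper m w u p q i (p' + r') (q' + s')) = pair_coef * (f * g).
Proof.
rewrite -sum_right -[RHS]subr0 -[X in _ = _ - X]sum_above -sumrB; apply: eq_bigr => s' _.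
rewrite -sumrB; apply: eq_bigr => r' _.
by rewrite terms_collapse //; ring.
Qed.

End WindowPair.

(** * The bracket of functions with triangular gradients *)

Section Entry.

Variables (R : pzRingType) (m n : nat).
Implicit Type A : 'M[R]_(m, n).

Lemma entryE A (i : 'I_m) (j : 'I_n) : entry A i j = A i j.
Proof. by rewrite /entry !valK. Qed.

Lemma entry_out A i j : (m <= i)%N || (n <= j)%N -> entry A i j = 0.
Proof.
rewrite /entry; case: insubP => [? lt_i _|_] //; case: insubP => [? lt_j _|_] //.
by case/orP; rewrite leqNgt ?lt_i ?lt_j.
Qed.

End Entry.

(** * The resolvents of the two shifts *)

Section Resolvent.

Variables (F : fieldType) (n : nat).
Implicit Types x y A B : 'M[F]_n.

Lemma gamma_plusE A i j : gamma_plus A i j = entry A i.+1 j.+1.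
Proof.
have shiftM B (a b : 'I_n) : (shift_mx F n *m B) a b = entry B a.+1 b.
  rewrite mxE; have [lt_a|le_a] := ltnP a.+1 n; last first.
    rewrite entry_out ?le_a // big1 // => c _; rewrite mxE.
    by rewrite (_ : _ == _ = false) ?mul0r //; have := ltn_ord c; lia.
  rewrite -[a.+1]/(val (Ordinal lt_a)) entryE (bigD1 (Ordinal lt_a)) //= mxE.
  rewrite eqxx mul1r big1 ?addr0 // => c; rewrite -val_eqE mxE /= => /negPf->.
  by rewrite mul0r.
rewrite /gamma_plus -mulmxA shiftM.
have [lt_i|le_i] := ltnP i.+1 n; last by rewrite !entry_out ?le_i.
rewrite -[i.+1]/(val (Ordinal lt_i)) entryE.
have -> : (A *m (shift_mx F n)^T) (Ordinal lt_i) j =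
          (shift_mx F n *m A^T) j (Ordinal lt_i).
  by rewrite -[A in LHS]trmxK -trmx_mul [LHS]mxE.
rewrite shiftM /=.
have [lt_j|le_j] := ltnP j.+1 n; last by rewrite !entry_out ?le_j ?orbT.
by rewrite -[j.+1]/(val (Ordinal lt_j)) -[i.+1]/(val (Ordinal lt_i)) !entryE mxE.
Qed.

Lemma gamma_minusE A i j :
  gamma_minus A i j = if (0 < i)%N && (0 < j)%N then entry A i.-1 j.-1 else 0.
Proof.
have shiftM B (a b : 'I_n) : ((shift_mx F n)^T *m B) a b =
    if (0 < a)%N then entry B a.-1 b else 0.
  rewrite mxE; case: ltnP => [lt_a|le_a]; last first.
    rewrite big1 // => c _; rewrite !mxE.
    by rewrite (_ : _ == _ = false) ?mul0r //; lia.
  have lt_a1 : (a.-1 < n)%N by have := ltn_ord a; lia.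
  rewrite -[a.-1]/(val (Ordinal lt_a1)) entryE (bigD1 (Ordinal lt_a1)) //= !mxE.
  rewrite (_ : _ == _ = true) ?mul1r ?big1 ?addr0 //=; last by lia.
  move=> c; rewrite -val_eqE !mxE /= => ne_c.
  by rewrite (_ : _ == _ = false) ?mul0r //; lia.
rewrite /gamma_minus -mulmxA shiftM.
case: ltnP => //= lt_i.
have lt_i1 : (i.-1 < n)%N by have := ltn_ord i; lia.
rewrite -[i.-1]/(val (Ordinal lt_i1)) entryE.
have -> : (A *m shift_mx F n) (Ordinal lt_i1) j =
          ((shift_mx F n)^T *m A^T) j (Ordinal lt_i1).
  by rewrite -trmx_mul [RHS]mxE.
rewrite shiftM; case: ltnP => //= lt_j.
have lt_j1 : (j.-1 < n)%N by have := ltn_ord j; lia.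
by rewrite -[j.-1]/(val (Ordinal lt_j1)) -[i.-1]/(val (Ordinal lt_i1)) !entryE mxE.
Qed.

Fact gamma_plus_linear : linear (@gamma_plus F n).
Proof.
by move=> a A B; rewrite /gamma_plus mulmxDr mulmxDl -scalemxAr -scalemxAl.
Qed.
HB.instance Definition _ :=
  GRing.isLinear.Build F 'M[F]_n 'M[F]_n *:%R (@gamma_plus F n) gamma_plus_linear.

Fact gamma_minus_linear : linear (@gamma_minus F n).
Proof.
by move=> a A B; rewrite /gamma_minus mulmxDr mulmxDl -scalemxAr -scalemxAl.
Qed.
HB.instance Definition _ :=
  GRing.isLinear.Build F 'M[F]_n 'M[F]_n *:%R (@gamma_minus F n)
    gamma_minus_linear.

Lemma iter_gamma_plusE d A (i j : 'I_n) :
  iter d (@gamma_plus F n) A i j = entry A (i + d) (j + d).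
Proof.
elim: d i j => [|d IHd] i j /=; first by rewrite !addn0 entryE.
rewrite gamma_plusE.
have [lt_i|le_i] := ltnP i.+1 n; last first.
  by rewrite !entry_out //; apply/orP; left; lia.
have [lt_j|le_j] := ltnP j.+1 n; last first.
  by rewrite !entry_out //; apply/orP; right; lia.
by rewrite -[i.+1]/(val (Ordinal lt_i)) -[j.+1]/(val (Ordinal lt_j)) entryE IHd
           /= !addnS.
Qed.

Lemma iter_gamma_minus0 d A (i j : 'I_n) :
  (i < d)%N -> iter d (@gamma_minus F n) A i j = 0.
Proof.
elim: d i j => [|d IHd] i j //= lt_i.
rewrite gamma_minusE; case: ifP => // /andP[i0 j0].
have lt_i1 : (i.-1 < n)%N by have := ltn_ord i; lia.
have lt_j1 : (j.-1 < n)%N by have := ltn_ord j; lia.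
rewrite -[j.-1]/(val (Ordinal lt_j1)) -[i.-1]/(val (Ordinal lt_i1)) entryE IHd //=.
by lia.
Qed.

Section Nilpotent.

Variable gamma : {linear 'M[F]_n -> 'M[F]_n}.
Hypothesis gamma_nil : forall A, iter n gamma A = 0.

(** A fixed point of [gamma] is killed by the [n]-th iterate; the trivial kernel gives the inverse
    in [resolvent] its meaning. *)
Lemma lker_sub_gamma : lker (\1 - linfun gamma)%VF == 0%VS.
Proof.
apply/lker0P => x y; rewrite !add_lfunE !opp_lfunE !id_lfunE !lfunE /= => eq_xy.
have fix_xy : gamma (x - y) = x - y.
  have gx : gamma x = x - (y - gamma y) by rewrite -eq_xy subKr.
  by rewrite linearB gx -addrA -opprD subrK.
have : iter n gamma (x - y) = x - y by apply: iter_fix.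
by rewrite gamma_nil => /esym/eqP; rewrite subr_eq0 => /eqP.
Qed.

Lemma resolventK A : resolvent gamma (A - gamma A) = A.
Proof.
have := lker0_lfunK lker_sub_gamma A.
by rewrite add_lfunE opp_lfunE id_lfunE lfunE.
Qed.

Lemma resolventE A : resolvent gamma A = \sum_(d < n) iter d gamma A.
Proof.
rewrite -[RHS]resolventK; congr (resolvent gamma _); rewrite linear_sum /=.
under [X in _ - X]eq_bigr do rewrite -iterS.
rewrite -sumrB; have := telescope_sumr (fun d => iter d gamma A) (leq0n n).
rewrite gamma_nil /= sub0r big_mkord => /(congr1 -%R); rewrite opprK => A_E.
by rewrite -[LHS]A_E -sumrN; apply: eq_bigr => d _; rewrite opprB.
Qed.

Lemma gammaK A : resolvent gamma A - gamma (resolvent gamma A) = A.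
Proof.
rewrite resolventE linear_sum -sumrB.
have := telescope_sumr (fun d => iter d gamma A) (leq0n n).
rewrite gamma_nil /= sub0r big_mkord => /(congr1 -%R); rewrite opprK => A_E.
by rewrite -[RHS]A_E -sumrN; apply: eq_bigr => d _; rewrite opprB.
Qed.

End Nilpotent.

End Resolvent.

Section RPlus.

Variables (F : fieldType) (n : nat).
Implicit Types x y A B : 'M[F]_n.

Local Notation Tp := (resolvent (@gamma_plus F n)).
Local Notation Tm := (resolvent (@gamma_minus F n)).

Lemma gamma_plus_nil A : iter n (@gamma_plus F n) A = 0.
Proof.
apply/matrixP => i j; rewrite iter_gamma_plusE mxE entry_out //.
by rewrite leq_addl.
Qed.

Lemma gamma_minus_nil A : iter n (@gamma_minus F n) A = 0.
Proof. by apply/matrixP => i j; rewrite iter_gamma_minus0 ?mxE. Qed.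

Lemma resolvent_plusK A : Tp (A - gamma_plus A) = A.
Proof. exact: resolventK gamma_plus_nil A. Qed.

Lemma resolvent_minusK A : Tm (A - gamma_minus A) = A.
Proof. exact: resolventK gamma_minus_nil A. Qed.

Lemma gamma_plusK A : Tp A - gamma_plus (Tp A) = A.
Proof. exact: gammaK gamma_plus_nil A. Qed.

Lemma gamma_minusK A : Tm A - gamma_minus (Tm A) = A.
Proof. exact: gammaK gamma_minus_nil A. Qed.

(** [gamma_plus] and [gamma_minus] are adjoint for the trace form, hence so are their resolvents. *)
Lemma trform_resolvent x y : \tr (Tm x *m y) = \tr (x *m Tp y).
Proof.
rewrite -[in RHS](gamma_minusK x) -[in LHS](gamma_plusK y).
rewrite mulmxBl mulmxBr !raddfB /=; congr (_ - _).
by rewrite /gamma_plus /gamma_minus !mulmxA [LHS]mxtrace_mulC !mulmxA.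
Qed.

Lemma resolvent_plusE A (i j : 'I_n) :
  Tp A i j = \sum_(d < n) entry A (i + d) (j + d).
Proof.
rewrite (resolventE gamma_plus_nil) summxE.
by apply: eq_bigr => d _; rewrite iter_gamma_plusE.
Qed.

Lemma resolvent_plus_diag A (i : 'I_n) :
  Tp A i i = \sum_(j < n) (i <= j)%:R * A j j.
Proof.
rewrite resolvent_plusE; pose E k := entry A k k.
transitivity (\sum_(0 <= d < n) E (d + i)).
  by rewrite big_mkord; apply: eq_bigr => d _; rewrite addnC.
transitivity (\sum_(0 + i <= k < n + i) E k); first by rewrite big_addn addnK.
rewrite add0n (big_cat_nat (n := n)) ?leq_addr //=; last by rewrite ltnW.
rewrite [X in _ + X]big_nat_cond [X in _ + X]big1 ?addr0; last first.
  by move=> k /andP[/andP[le_k _] _]; rewrite /E entry_out ?le_k.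
rewrite (big_nat_widenl _ 0) // big_mkord big_mkcond /=.
by apply: eq_bigr => j _; rewrite /E entryE; case: leqP => _; bring.
Qed.

Lemma resolvent_plus_lower A : (forall i j : 'I_n, (i < j)%N -> A i j = 0) ->
  forall i j : 'I_n, (i < j)%N -> Tp A i j = 0.
Proof.
move=> A0 i j lt_ij; rewrite resolvent_plusE big1 // => d _.
have [lt_j|le_j] := ltnP (j + d) n; last by rewrite entry_out ?le_j ?orbT.
have lt_i : (i + d < n)%N by lia.
rewrite -[(j + d)%N]/(val (Ordinal lt_j)) -[(i + d)%N]/(val (Ordinal lt_i)).
by rewrite entryE A0 //= ltn_add2r.
Qed.

Lemma resolvent_minus_upper A : (forall i j : 'I_n, (j < i)%N -> A i j = 0) ->
  forall i j : 'I_n, (j < i)%N -> Tm A i j = 0.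
Proof.
move=> A0 i j lt_ij; rewrite (resolventE gamma_minus_nil) summxE big1 // => d _.
elim: {d}(nat_of_ord d) i j lt_ij => [|d IHd] i j lt_ij /=; first exact: A0.
rewrite gamma_minusE; case: ifP => // /andP[i0 j0].
have lt_i : (i.-1 < n)%N by have := ltn_ord i; lia.
have lt_j : (j.-1 < n)%N by have := ltn_ord j; lia.
rewrite -[j.-1]/(val (Ordinal lt_j)) -[i.-1]/(val (Ordinal lt_i)).
by rewrite entryE IHd //=; lia.
Qed.

Fact upper_part_linear : linear (@upper_part F n).
Proof.
by move=> a A B; apply/matrixP => i j; rewrite !mxE; case: ifP; rewrite ?mulr0 ?addr0.
Qed.
HB.instance Definition _ :=
  GRing.isLinear.Build F 'M[F]_n 'M[F]_n *:%R (@upper_part F n) upper_part_linear.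

Fact lower_part_linear : linear (@lower_part F n).
Proof.
by move=> a A B; apply/matrixP => i j; rewrite !mxE; case: ifP; rewrite ?mulr0 ?addr0.
Qed.
HB.instance Definition _ :=
  GRing.isLinear.Build F 'M[F]_n 'M[F]_n *:%R (@lower_part F n) lower_part_linear.

Lemma upper_lower A : upper_part A + lower_part A = A.
Proof.
by apply/matrixP => i j; rewrite !mxE ltnNge; case: leqP; rewrite ?addr0 ?add0r.
Qed.

Lemma upper_gamma_plus A : upper_part (gamma_plus A) = gamma_plus (upper_part A).
Proof.
apply/matrixP => i j; rewrite mxE !gamma_plusE.
have [lt_i|le_i] := ltnP i.+1 n; last by rewrite !entry_out ?le_i //; case: ifP.
have [lt_j|le_j] := ltnP j.+1 n; last first.
  by rewrite !entry_out ?le_j ?orbT //; case: ifP.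
rewrite -[j.+1]/(val (Ordinal lt_j)) -[i.+1]/(val (Ordinal lt_i)) !entryE.
by rewrite !mxE /= ltnS.
Qed.

Lemma lower_gamma_minus A :
  lower_part (gamma_minus A) = gamma_minus (lower_part A).
Proof.
apply/matrixP => i j; rewrite mxE !gamma_minusE.
case: (ltnP 0 i) => [i0|] /=; last by case: ifP.
case: (ltnP 0 j) => [j0|] /=; last by case: ifP.
have lt_i : (i.-1 < n)%N by have := ltn_ord i; lia.
have lt_j : (j.-1 < n)%N by have := ltn_ord j; lia.
rewrite -[j.-1]/(val (Ordinal lt_j)) -[i.-1]/(val (Ordinal lt_i)) !entryE.
by rewrite !mxE /= (_ : (j.-1 <= i.-1)%N = (j <= i)%N) //; lia.
Qed.

Lemma trace_lower_lower A B : (forall i j : 'I_n, (i < j)%N -> B i j = 0) ->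
  \tr (lower_part A *m B) = \sum_i A i i * B i i.
Proof.
move=> B0; apply: eq_bigr => i _; rewrite mxE (bigD1 i) //= mxE leqnn.
rewrite big1 ?addr0 // => j ne_ji; rewrite mxE; case: leqP => [le_ji|_].
  by rewrite B0 ?mulr0 // ltn_neqAle le_ji andbT.
by rewrite mul0r.
Qed.

Lemma trace_upper_upper A B : (forall i j : 'I_n, (j < i)%N -> B i j = 0) ->
  \tr (upper_part A *m B) = 0.
Proof.
move=> B0; rewrite /mxtrace big1 // => i _; rewrite mxE big1 // => j _.
by rewrite mxE; case: leqP => [_|/B0 ->]; rewrite ?mul0r ?mulr0.
Qed.

Definition trace_term A : 'M[F]_n :=
  (n.-1%:R / (2 * n)%:R * \tr A)%:M
  + n%:R^-1 *: (\tr A *: D_mx F n - (\tr (D_mx F n *m A))%:M).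

Lemma trace_trace_term A B : \tr (trace_term A *m B) =
  n.-1%:R / (2 * n)%:R * \tr A * \tr B
  + n%:R^-1 * (\tr A * \tr (D_mx F n *m B) - \tr (D_mx F n *m A) * \tr B).
Proof.
rewrite /trace_term mulmxDl -scalemxAl mulmxBl -scalemxAl !mul_scalar_mx.
by rewrite mxtraceD !mxtraceZ linearB /= !mxtraceZ.
Qed.

Lemma R_plus_trace_term A : R_plus A =
  Tp (upper_part A) - gamma_minus (Tm (lower_part A)) + trace_term A.
Proof. by rewrite /R_plus /trace_term !addrA. Qed.

(** The shift falls on [x] in the first resolvent and on [y] in the second. The leftovers are
    [upper_part x] and, after applying [gamma_minus], [lower_part x]; they add up to the plain
    summand [x]. *)
Lemma R_plus_split x y : R_plus (x + y) =
  Tp (upper_part (gamma_plus x + y)) + x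
  - Tm (lower_part (x + gamma_minus y)) + trace_term (x + y).
Proof.
rewrite R_plus_trace_term; congr (_ + _).
have -> : Tp (upper_part (x + y)) =
    Tp (upper_part (gamma_plus x + y)) + upper_part x.
  rewrite -[X in _ = _ + X](resolvent_plusK) -linearD; congr (Tp _).
  rewrite -upper_gamma_plus; move: (gamma_plus x) => z.
  by apply/matrixP => i j; rewrite !mxE; case: ifP => _; ring.
have -> : Tm (lower_part (x + y)) =
    Tm (lower_part (x + gamma_minus y)) + lower_part y.
  rewrite -[X in _ = _ + X](resolvent_minusK) -linearD; congr (Tm _).
  rewrite -lower_gamma_minus; move: (gamma_minus y) => z.
  by apply/matrixP => i j; rewrite !mxE; case: ifP => _; ring.
set z := Tm _.
have -> : gamma_minus (z + lower_part y) = z - lower_part x.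
  have zE := gamma_minusK (lower_part (x + gamma_minus y)).
  rewrite linearD /= -lower_gamma_minus -[X in X + _](subKr z) zE.
  move: (z) (gamma_minus y) => a b.
  by apply/matrixP => i j; rewrite !mxE; case: ifP => _; ring.
rewrite -[X in _ = _ + X - _](upper_lower x) opprB.
move: (Tp _) (upper_part x) (lower_part x) => a b c.
by apply/matrixP => i j; rewrite !mxE; ring.
Qed.

End RPlus.

(** * Trace formulas for [R_plus] and skew symmetry *)

Section Bracket.

Variables (F : fieldType) (n : nat).
Implicit Types (x y X : 'M[F]_n) (f g : {mpoly F[n * n]}).

Local Notation Tp := (resolvent (@gamma_plus F n)).
Local Notation Tm := (resolvent (@gamma_minus F n)).

Lemma trform_resolventC x y : \tr (Tp x *m y) = \tr (x *m Tm y).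
Proof. by rewrite mxtrace_mulC -trform_resolvent mxtrace_mulC. Qed.

Lemma resolvent_plus_split x y : Tp (x + y) = Tp (gamma_plus x + y) + x.
Proof.
rewrite -[X in _ = _ + X]resolvent_plusK -linearD; congr (Tp _).
by move: (gamma_plus x) => z; apply/matrixP => i j; rewrite !mxE; ring.
Qed.

Lemma resolvent_minus_split x y : Tm (x + y) = Tm (x + gamma_minus y) + y.
Proof.
rewrite -[X in _ = _ + X]resolvent_minusK -linearD; congr (Tm _).
by move: (gamma_minus y) => z; apply/matrixP => i j; rewrite !mxE; ring.
Qed.

Lemma trace_R_plus x y x' y' : \tr (R_plus (x + y) *m (x' + y')) =
  \tr (upper_part (gamma_plus x + y) *m Tm (x' + gamma_minus y'))
  + \tr (upper_part (gamma_plus x + y) *m y') + \tr (x *m (x' + y'))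
  - \tr (lower_part (x + gamma_minus y) *m Tp (gamma_plus x' + y'))
  - \tr (lower_part (x + gamma_minus y) *m x')
  + \tr (trace_term (x + y) *m (x' + y')).
Proof.
rewrite R_plus_split !mulmxDl mulNmx !mxtraceD linearN /=.
rewrite trform_resolventC trform_resolvent.
rewrite resolvent_minus_split resolvent_plus_split.
rewrite [upper_part _ *m (_ + _)]mulmxDr [lower_part _ *m (_ + _)]mulmxDr !mxtraceD.
ring.
Qed.

(** The trace of [lower_part x] times [Tp (lower_part y)]: both factors are lower triangular, so
    only the diagonals count. *)
Definition diag_form (x y : 'M[F]_n) :=
  \sum_(i < n) \sum_(j < n) (i <= j)%:R * (x i i * y j j).

Lemma lower_part_strict x (i j : 'I_n) : (i < j)%N -> lower_part x i j = 0.
Proof. by move=> lt_ij; rewrite mxE leqNgt lt_ij. Qed.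

Lemma upper_part_strict x (i j : 'I_n) : (j < i)%N -> upper_part x i j = 0.
Proof. by move=> lt_ij; rewrite mxE ltnNge ltnW. Qed.

Lemma trace_resolvent_upper x y :
  \tr (Tp (upper_part x) *m y) = \tr (lower_part y *m Tp (upper_part x)).
Proof.
rewrite [RHS]mxtrace_mulC !trform_resolventC -[in LHS](upper_lower y) linearD /=.
rewrite mulmxDr mxtraceD trace_upper_upper ?add0r //.
exact/resolvent_minus_upper/upper_part_strict.
Qed.

(** The first two terms are arranged to change sign when [x] and [y] are exchanged, so that they
    drop out of the symmetrization. *)
Lemma trace_R_plus1 x y : \tr (R_plus x *m y) =
  \tr (lower_part y *m Tp (upper_part x)) - \tr (lower_part x *m Tp (upper_part y))
  - diag_form x y + \tr (lower_part x *m y) + \tr (trace_term x *m y).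
Proof.
have -> : R_plus x =
    Tp (upper_part x) - Tm (lower_part x) + lower_part x + trace_term x.
  have gTm a : gamma_minus (Tm a) = Tm a - a.
    by rewrite -[X in _ - X]gamma_minusK subKr.
  rewrite R_plus_trace_term gTm opprB; congr (_ + trace_term x).
  by rewrite addrA addrAC.
rewrite !mulmxDl mulNmx !mxtraceD linearN /= trform_resolvent trace_resolvent_upper.
rewrite -[in Tp y](upper_lower y) linearD /= mulmxDr mxtraceD.
rewrite [\tr (lower_part x *m Tp (lower_part y))]trace_lower_lower; last first.
  exact/resolvent_plus_lower/lower_part_strict.
rewrite (eq_bigr (fun i : 'I_n => \sum_(j < n) (i <= j)%:R * (x i i * y j j))).
  by rewrite opprD !addrA.
move=> i _; rewrite resolvent_plus_diag mulr_sumr; apply: eq_bigr => j _.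
by rewrite mxE leqnn; ring.
Qed.

Lemma diag_form_sym x y :
  diag_form x y + diag_form y x = \tr x * \tr y + \sum_i x i i * y i i.
Proof.
rewrite /diag_form [X in _ + X]exchange_big /mxtrace mulr_suml -!big_split.
apply: eq_bigr => i _ /=; rewrite mulr_sumr -big_split /=.
rewrite -(sum_delta i (fun j => x i i * y j j)) -big_split /=.
apply: eq_bigr => j _; rewrite -val_eqE /=.
by case: (ltngtP i j) => [lt|lt|/val_inj->]; bring.
Qed.

Lemma trace_lower_sym x y :
  \tr (lower_part x *m y) + \tr (lower_part y *m x) =
  \tr (x *m y) + \sum_i x i i * y i i.
Proof.
have diagE : \tr (lower_part x *m lower_part y) = \sum_i x i i * y i i.
  rewrite trace_lower_lower; last exact: lower_part_strict.
  by apply: eq_bigr => i _; rewrite mxE leqnn.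
have upE : \tr (upper_part x *m y) = \tr (upper_part x *m lower_part y).
  rewrite -{1}(upper_lower y) mulmxDr mxtraceD trace_upper_upper ?add0r //.
  exact: upper_part_strict.
rewrite [\tr (lower_part y *m x)]mxtrace_mulC -{2 3}(upper_lower x).
by rewrite !mulmxDl !mxtraceD upE diagE; ring.
Qed.

(** The sums of [x i i * y i i] in [diag_form_sym] and [trace_lower_sym] cancel, and the [D_mx]
    terms are skew. The [-1] comes from [diag_form]. *)
Lemma R_plus_sym x y : \tr (R_plus x *m y) + \tr (x *m R_plus y) =
  \tr (x *m y) + (n.-1%:R / (2 * n)%:R *+ 2 - 1) * (\tr x * \tr y).
Proof.
have diagE := diag_form_sym x y; have lowE := trace_lower_sym x y.
rewrite [\tr (x *m R_plus y)]mxtrace_mulC !trace_R_plus1 !trace_trace_term.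
transitivity (\tr (lower_part x *m y) + \tr (lower_part y *m x)
  - (diag_form x y + diag_form y x)
  + (n.-1%:R / (2 * n)%:R *+ 2) * (\tr x * \tr y)); first by ring.
by rewrite diagE lowE; ring.
Qed.

(** The right-hand side of [R_plus_sym] involves only the traces of [x], [y] and [x *m y], and these
    agree for the products of the gradients with [X] on either side. *)
Lemma CG_bracket_skew f g X : CG_bracket f g X = - CG_bracket g f X.
Proof.
have symL := R_plus_sym (grad f X *m X) (grad g X *m X).
have symR := R_plus_sym (X *m grad f X) (X *m grad g X).
have trE : \tr (X *m grad f X *m (X *m grad g X)) =
           \tr (grad f X *m X *m (grad g X *m X)).
  by rewrite !mulmxA [RHS]mxtrace_mulC !mulmxA.
rewrite mxtrace_mulC [X in _ + X]mxtrace_mulC in symL.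
rewrite trE ![\tr (X *m _)]mxtrace_mulC in symR.
rewrite /CG_bracket /trform; apply/eqP; rewrite -subr_eq0 opprK; apply/eqP.
move: symL; rewrite -symR => /eqP; rewrite -subr_eq0 => /eqP <-.
rewrite [\tr (X *m grad f X *m _)]mxtrace_mulC.
rewrite [\tr (R_plus (grad f X *m X) *m _)]mxtrace_mulC.
ring.
Qed.

End Bracket.

(** * Reduction of the bracket to three traces *)

Section Graded.

Variables (F : fieldType) (n : nat).
Implicit Types (X GX GY : 'M[F]_n) (f g : {mpoly F[n * n]}).

Local Notation Tp := (resolvent (@gamma_plus F n)).
Local Notation Tm := (resolvent (@gamma_minus F n)).

(* The factors of proportionality to [f] in [graded_at]; they must not depend on
   the point [X], since they enter the constant of the bracket. *)
Record weights := Weights {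
  wL : 'I_n -> F; wL' : 'I_n -> F; wR : 'I_n -> F; wR' : 'I_n -> F;
  wT : F; wTL : F; wTR : F }.

(** An entry of [X] sits one row and one column off between an [X] block and a [Y] block; shifting
    one of the two parts of the gradient aligns them. The prime marks alignment by [gamma_plus], and
    [L] or [R] the gradient as left or right factor. *)
Definition gradL X GX GY := GX *m X + gamma_minus (GY *m X).
Definition gradL' X GX GY := gamma_plus (GX *m X) + GY *m X.
Definition gradR X GX GY := X *m GX + gamma_minus (X *m GY).
Definition gradR' X GX GY := gamma_plus (X *m GX) + X *m GY.

(** No triangularity is asked of [gradL] and [gradR']: their lower and strictly upper parts enter
    [bracket_rest]. *)
Record graded_at (c : weights) X GX GY (v : F) : Prop := GradedAt {
  gradL_diag : forall i, gradL X GX GY i i = v * wL c i;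
  gradL'_upper : forall i j : 'I_n, (i < j)%N -> gradL' X GX GY i j = 0;
  gradL'_diag : forall i, gradL' X GX GY i i = v * wL' c i;
  gradR_lower : forall i j : 'I_n, (j < i)%N -> gradR X GX GY i j = 0;
  gradR_diag : forall i, gradR X GX GY i i = v * wR c i;
  gradR'_diag : forall i, gradR' X GX GY i i = v * wR' c i;
  grad_trace : \tr ((GX + GY) *m X) = v * wT c;
  grad_traceL : \tr (D_mx F n *m ((GX + GY) *m X)) = v * wTL c;
  grad_traceR : \tr (D_mx F n *m (X *m (GX + GY))) = v * wTR c }.

Definition weight_form (a b : 'I_n -> F) : F :=
  \sum_(i < n) \sum_(j < n) (i <= j)%:R * (a i * b j).

Definition weights_coef (c c' : weights) : F :=
  weight_form (wR c) (wR' c') - weight_form (wL c) (wL' c')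
  + n%:R^-1 * ((wT c * wTL c' - wTL c * wT c') - (wT c * wTR c' - wTR c * wT c')).

Definition bracket_rest X GX GY GX' GY' : F :=
  \tr (lower_part (gradR X GX GY) *m (X *m GX'))
  - \tr (lower_part (gradL X GX GY) *m (GX' *m X))
  - \tr (upper_part (gradR' X GX GY) *m (X *m GY')).

Lemma trace_lower_diag (B M : 'M[F]_n) :
  (forall i j : 'I_n, (j < i)%N -> B i j = 0) ->
  \tr (lower_part B *m M) = \sum_i B i i * M i i.
Proof.
move=> B0; apply: eq_bigr => i _; rewrite mxE (bigD1 i) //= mxE leqnn.
rewrite big1 ?addr0 // => j ne_ji; rewrite mxE; case: leqP => [le_ji|_].
  by rewrite B0 ?mul0r // ltn_neqAle le_ji andbT.
by rewrite mul0r.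
Qed.

Lemma sum_resolvent_plus (B M : 'M[F]_n) (v v' : F) (a b : 'I_n -> F) :
  (forall i, B i i = v * a i) -> (forall i, M i i = v' * b i) ->
  \sum_i B i i * Tp M i i = v * v' * weight_form a b.
Proof.
move=> BE ME; rewrite /weight_form mulr_sumr; apply: eq_bigr => i _.
rewrite resolvent_plus_diag !mulr_sumr; apply: eq_bigr => j _.
by rewrite BE ME; ring.
Qed.

Lemma CG_bracket_graded f g c c' X GX GY GX' GY' :
  grad f X = GX + GY -> grad g X = GX' + GY' ->
  graded_at c X GX GY (evalf f X) -> graded_at c' X GX' GY' (evalf g X) ->
  CG_bracket f g X = bracket_rest X GX GY GX' GY'
    + weights_coef c c' * (evalf f X * evalf g X).
Proof.
move=> fE gE fG gG; rewrite /CG_bracket /trform fE gE.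
rewrite ![(_ + _) *m X]mulmxDl ![X *m (_ + _)]mulmxDr !trace_R_plus.
rewrite -/(gradL X GX GY) -/(gradL' X GX GY) -/(gradR X GX GY) -/(gradR' X GX GY).
rewrite -/(gradL X GX' GY') -/(gradL' X GX' GY').
rewrite -/(gradR X GX' GY') -/(gradR' X GX' GY').
have -> : upper_part (gradL' X GX GY) = 0.
  apply/matrixP => i j; rewrite [LHS]mxE [RHS]mxE; case: ifP => // lt_ij.
  by rewrite (gradL'_upper fG).
rewrite !mul0mx mxtrace0 [\tr (upper_part _ *m Tm _)]trace_upper_upper; last first.
  exact: resolvent_minus_upper (gradR_lower gG).
rewrite [\tr (lower_part (gradL _ _ _) *m Tp _)]trace_lower_lower; last first.
  exact: resolvent_plus_lower (gradL'_upper gG).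
rewrite [\tr (lower_part (gradR _ _ _) *m Tp _)]trace_lower_diag; last first.
  exact: gradR_lower fG.
rewrite (sum_resolvent_plus (gradL_diag fG) (gradL'_diag gG)).
rewrite (sum_resolvent_plus (gradR_diag fG) (gradR'_diag gG)).
rewrite -!mulmxDl -!mulmxDr !trace_trace_term.
rewrite ![\tr (X *m (_ + _))]mxtrace_mulC (grad_trace fG) (grad_trace gG).
rewrite (grad_traceL fG) (grad_traceL gG) (grad_traceR fG) (grad_traceR gG).
(* The plain summand of [R_plus_split] contributes equally on both sides of the bracket and
   cancels. *)
have -> : \tr (X *m GX *m (X *m (GX' + GY'))) =
          \tr (GX *m X *m ((GX' + GY') *m X)).
  by rewrite !mulmxA [RHS]mxtrace_mulC !mulmxA.
rewrite /bracket_rest /weights_coef; ring.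
Qed.

End Graded.

(** * Gradients of the minors of [U(X,X)] *)

Section DetDerivative.

Variables (R : comNzRingType) (N : nat).

Lemma mderiv_prod_ord i (A : 'I_i -> {mpoly R[N]}) v :
  (\prod_k A k)^`M(v) = \sum_j (A j)^`M(v) * \prod_(k | j != k) A k.
Proof.
elim: i A => [|i IHi] A; first by rewrite !big_ord0 -mpolyC1 mderivC.
rewrite !big_ord_recl mderivM IHi [in RHS]big_mkcond [in RHS]big_ord_recl /=.
rewrite mul1r; congr (_ * _ + _).
rewrite mulr_sumr; apply: eq_bigr => j _.
rewrite [X in _ = _ * X]big_mkcond big_ord_recl /= mulrCA; congr (_ * (_ * _)).
by rewrite big_mkcond; apply: eq_bigr => k _; rewrite (inj_eq lift_inj).
Qed.

(** Jacobi's formula: the permutations are grouped by their value at row [r], and each group sums to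
    a cofactor. *)
Lemma mderiv_det i (M : 'M[{mpoly R[N]}]_i) v :
  (\det M)^`M(v) = \sum_s \sum_r \adj M s r * (M r s)^`M(v).
Proof.
rewrite /determinant raddf_sum exchange_big /=.
transitivity (\sum_r \sum_(t : 'S_i)
    (-1) ^+ t * ((M r (t r))^`M(v) * \prod_(k | r != k) M k (t k))).
  rewrite exchange_big; apply: eq_bigr => t _; rewrite -mulr_sumr -mderiv_prod_ord.
  by rewrite -signr_odd; case: (odd _); rewrite ?mulN1r ?raddfN ?mul1r.
apply: eq_bigr => r _; rewrite (partition_big (fun t : 'S_i => t r) xpredT) //=.
apply: eq_bigr => s _; rewrite mxE expand_cofactor mulr_suml.
by apply: eq_bigr => t /eqP->; rewrite mulrCA mulrC.
Qed.

End DetDerivative.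

Section Gradient.

Variables (F : fieldType) (n : nat).
Implicit Types (X : 'M[F]_n) (f g : {mpoly F[n * n]}).

Definition evalm X : {mpoly F[n * n]} -> F := meval (fun v => mxvec X 0 v).
HB.instance Definition _ X := GRing.RMorphism.on (evalm X).

Lemma grad_det i (M : 'M[{mpoly F[n * n]}]_i) X (j l : 'I_n) :
  grad (\det M) X j l =
  \sum_s \sum_r \adj (map_mx (evalm X) M) s r * evalm X (M r s)^`M(mxvec_index l j).
Proof.
rewrite mxE /evalf -/(evalm X) mderiv_det raddf_sum; apply: eq_bigr => s _.
rewrite raddf_sum; apply: eq_bigr => r _.
by rewrite [LHS](rmorphM (evalm X)) -map_mx_adj [in RHS]mxE.
Qed.

Lemma eval_entry_genmat X a b : evalm X (entry (genmat F n) a b) = entry X a b.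
Proof.
have [/andP[lt_a lt_b]|] := boolP ((a < n)%N && (b < n)%N); last first.
  by rewrite negb_and -!leqNgt => out; rewrite !entry_out // raddf0.
rewrite -[a]/(val (Ordinal lt_a)) -[b]/(val (Ordinal lt_b)) !entryE mxE.
by rewrite /evalm mevalXU mxvecE.
Qed.

Lemma mxvec_index_eq (a b c d : 'I_n) :
  (mxvec_index a b == mxvec_index c d) = (a == c) && (b == d).
Proof.
apply/eqP/andP => [E|[/eqP-> /eqP->]] //.
by have [-> ->] := enum_rank_inj (cast_ord_inj E).
Qed.

Lemma deriv_entry_genmat X a b (j l : 'I_n) :
  evalm X (entry (genmat F n) a b)^`M(mxvec_index l j) =
  (a == l)%:R * (b == j)%:R.
Proof.
have [/andP[lt_a lt_b]|] := boolP ((a < n)%N && (b < n)%N); last first.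
  rewrite negb_and -!leqNgt => out; rewrite !entry_out // mderiv0 raddf0.
  by case: eqVneq => [al|_]; case: eqVneq => [bj|_]; rewrite ?mulr0 ?mul0r //;
     move: out; rewrite al bj leqNgt ltn_ord leqNgt ltn_ord.
rewrite -[a]/(val (Ordinal lt_a)) -[b]/(val (Ordinal lt_b)) !entryE mxE.
rewrite mderivX mnm1E mxvec_index_eq !val_eqE.
case: eqVneq => [->|_] /=; last by rewrite scale0r raddf0 mul0r.
case: eqVneq => [->|_] /=; last by rewrite scale0r raddf0 mulr0.
have -> : (U_(mxvec_index l j) - U_(mxvec_index l j) = 0)%MM.
  by apply/mnmP => k; rewrite mnmBE subnn mnm0E.
by rewrite scale1r mpolyX0 rmorph1 mulr1.
Qed.

End Gradient.

(** [mxblock] addresses entries by dependent block indices; for blocks of constant size these are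
    quotient and remainder. *)
Lemma tagnat_const k d (s : 'I_(\sum_(a < k) d)) :
  (tagnat.sig1 s = s %/ d :> nat)%N /\ (tagnat.sig2 s = s %% d :> nat)%N.
Proof.
have d_gt0 : (0 < d)%N by apply: leq_ltn_trans (ltn_ord (tagnat.sig2 s)).
have sE : (nat_of_ord s = tagnat.sig1 s * d + tagnat.sig2 s)%N.
  rewrite -{1}(tagnat.sig2K s) tagnat.RankEsum; congr (_ + _)%N.
  rewrite -(big_ord_widen k (fun=> d)) ?sum_nat_const ?card_ord //.
  exact/ltnW/ltn_ord.
rewrite sE divnMDl // modnMDl modn_small ?ltn_ord //.
by rewrite divn_small ?ltn_ord // addn0.
Qed.

(** * Entries of [U(X,X)] and block translation *)

Section BandEntries.

Variables (R : pzRingType) (n : nat).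

Local Notation rb h := (h %/ n.-1)%N.
Local Notation ri h := (h %% n.-1)%N.
Local Notation cb k := (k %/ n.+1)%N.
Local Notation ci k := (k %% n.+1)%N.

(** Generic in [e], to cover a numerical matrix, the generic matrix and the Kronecker deltas of
    partial derivatives. In each use [e] vanishes at column [n], which gives the zero column of
    [calX]; that of [calY] is the guard [0 < ci k] in [cgY]. *)
Definition cgX (e : nat -> nat -> R) (h k : nat) : R :=
  (cb k == (rb h).+1)%:R * e (ri h).+1 (ci k).

Definition cgY (e : nat -> nat -> R) (h k : nat) : R :=
  (cb k == rb h)%:R * ((0 < ci k)%:R * e (ri h) (ci k).-1).

(* The entries of [U(X,X)] for [e] the entries of [X], at 0-based positions and
   with the block structure continued past the [k] block rows. *)
Definition cgU (e : nat -> nat -> R) (h k : nat) : R := cgX e h k + cgY e h k.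

Lemma entry_calX (X : 'M[R]_n) (i : 'I_n.-1) (j : 'I_n.+1) :
  calX X i j = entry X i.+1 j.
Proof.
rewrite castmxE mxE; case: splitP => [j' jE|j' jE].
  by rewrite mxE /= add0n add1n -jE.
rewrite mxE entry_out //= -[nat_of_ord j]/(val (cast_ord (esym (addn1 n)) j)).
by rewrite /= in jE *; rewrite jE leq_addr orbT.
Qed.

Lemma entry_calY (X : 'M[R]_n) (i : 'I_n.-1) (j : 'I_n.+1) :
  calY X i j = (0 < j)%:R * entry X i j.-1.
Proof.
rewrite castmxE mxE; case: splitP => [j' jE|j' jE] /=; rewrite /= in jE.
  by rewrite mxE jE ord1 mul0r.
by rewrite mxE jE /= !add0n mul1r.
Qed.

Lemma entry_matU k (X : 'M[R]_n) h l : (h < k * n.-1)%N -> (l < k.+1 * n.+1)%N ->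
  entry (matU k X X) h l = cgU (entry X) h l.
Proof.
move=> lt_h lt_l.
have lt_h' : (h < \sum_(a < k) n.-1)%N by rewrite sum_nat_const card_ord.
have lt_l' : (l < \sum_(a < k.+1) n.+1)%N by rewrite sum_nat_const card_ord.
rewrite -[h]/(val (Ordinal lt_h')) -[l]/(val (Ordinal lt_l')) entryE mxE.
have [/= h1 h2] := tagnat_const (Ordinal lt_h').
have [/= l1 l2] := tagnat_const (Ordinal lt_l').
rewrite h1 l1 /cgU /cgX /cgY /=.
case: eqP => [E|_].
  by rewrite entry_calY h2 l2 E (_ : (_ == _.+1) = false) ?mul0r ?add0r ?mul1r //; lia.
case: eqP => [E|_]; first by rewrite entry_calX h2 l2 mul0r addr0 mul1r.
by rewrite mxE !mul0r addr0.
Qed.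

End BandEntries.

Section EntrySums.

Variables (R : comNzRingType) (m n : nat) (A : 'M[R]_(m, n)).

Lemma sum_entry_row (a : nat) (j : 'I_n) : \sum_(i < m) (a == i)%:R * A i j = entry A a j.
Proof.
have [lt_a|le_a] := ltnP a m; last first.
  rewrite entry_out ?le_a // big1 // => i _.
  by rewrite (_ : (a == i) = false) ?mul0r //; have := ltn_ord i; lia.
rewrite -[a in RHS]/(val (Ordinal lt_a)) entryE.
rewrite -(sum_delta (Ordinal lt_a) (fun i => A i j)).
by apply: eq_bigr => i _; rewrite -val_eqE eq_sym.
Qed.

Lemma sum_entry_col (i : 'I_m) (b : nat) : \sum_(j < n) (b == j)%:R * A i j = entry A i b.
Proof.
have [lt_b|le_b] := ltnP b n; last first.
  rewrite entry_out ?le_b ?orbT // big1 // => j _.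
  by rewrite (_ : (b == j) = false) ?mul0r //; have := ltn_ord j; lia.
rewrite -[b in RHS]/(val (Ordinal lt_b)) entryE.
rewrite -(sum_delta (Ordinal lt_b) (fun j => A i j)).
by apply: eq_bigr => j _; rewrite -val_eqE eq_sym.
Qed.

End EntrySums.

Section BandShift.

Variables (R : pzRingType) (n : nat).
Hypothesis n_gt1 : (1 < n)%N.
Variable e : nat -> nat -> R.
Implicit Types p q t r s : nat.

Lemma shift_rb p t r :
  ((p + t * n.-1 + r) %/ n.-1 = (p + r) %/ n.-1 + t)%N.
Proof. by rewrite addnAC addnC divnMDl 1?addnC //; lia. Qed.

Lemma shift_ri p t r : ((p + t * n.-1 + r) %% n.-1 = (p + r) %% n.-1)%N.
Proof. by rewrite addnAC addnC modnMDl. Qed.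

Lemma shift_cb q t s : ((q + t * n.+1 + s) %/ n.+1 = (q + s) %/ n.+1 + t)%N.
Proof. by rewrite addnAC addnC divnMDl 1?addnC. Qed.

Lemma shift_ci q t s : ((q + t * n.+1 + s) %% n.+1 = (q + s) %% n.+1)%N.
Proof. by rewrite addnAC addnC modnMDl. Qed.

Lemma shift_cgX p q t r s :
  cgX n e (p + t * n.-1 + r) (q + t * n.+1 + s) = cgX n e (p + r) (q + s).
Proof. by rewrite /cgX shift_rb shift_ri shift_cb shift_ci -addSn eqn_add2r. Qed.

Lemma shift_cgY p q t r s :
  cgY n e (p + t * n.-1 + r) (q + t * n.+1 + s) = cgY n e (p + r) (q + s).
Proof. by rewrite /cgY shift_rb shift_ri shift_cb shift_ci eqn_add2r. Qed.

End BandShift.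

Lemma shift_window (R : comNzRingType) n (n_gt1 : (1 < n)%N) (e : nat -> nat -> R)
    p q i t :
  window (cgU n e) (p + t * n.-1) (q + t * n.+1) i = window (cgU n e) p q i.
Proof.
by apply/matrixP => r s; rewrite !mxE /cgU shift_cgX // shift_cgY.
Qed.

(** * Gradients of minors as sums of diagonal blocks *)

Section BandMinor.

Variables (F : fieldType) (n : nat) (X : 'M[F]_n) (p q i : nat).
Hypothesis n_gt1 : (1 < n)%N.

Local Notation rb h := (h %/ n.-1)%N.
Local Notation ri h := (h %% n.-1)%N.
Local Notation cb k := (k %/ n.+1)%N.
Local Notation ci k := (k %% n.+1)%N.
Local Notation e := (entry X).
Local Notation u := (cgU n e).
Local Notation G := (\adj (window u p q i)).
Local Notation f := (\det (window u p q i)).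

(* The contributions to the gradient of the minor of [U(X,Y)], at [Y = X], of the
   entries from [X] and of those from [Y]; [p] and [q] are 0-based. *)
Definition minorX : 'M[F]_n := \matrix_(j, l) \sum_(s < i) \sum_(r < i)
  G s r * cgX n (fun a b => (a == l)%:R * (b == j)%:R) (p + r) (q + s).

Definition minorY : 'M[F]_n := \matrix_(j, l) \sum_(s < i) \sum_(r < i)
  G s r * cgY n (fun a b => (a == l)%:R * (b == j)%:R) (p + r) (q + s).

Lemma minorXl j l : (minorX *m X) j l = \sum_(s < i) \sum_(r < i) G s r *
  ((cb (q + s) == (rb (p + r)).+1)%:R *
   ((ci (q + s) == j)%:R * e (ri (p + r)).+1 l)).
Proof.
rewrite mxE; under eq_bigr do rewrite mxE mulr_suml.
rewrite exchange_big; apply: eq_bigr => s _; under eq_bigr do rewrite mulr_suml.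
rewrite exchange_big; apply: eq_bigr => r _; rewrite -sum_entry_row !mulr_sumr.
by apply: eq_bigr => l' _; rewrite /cgX; ring.
Qed.

Lemma minorYl j l : (minorY *m X) j l = \sum_(s < i) \sum_(r < i) G s r *
  ((cb (q + s) == rb (p + r))%:R *
   ((ci (q + s) == j.+1)%:R * e (ri (p + r)) l)).
Proof.
rewrite mxE; under eq_bigr do rewrite mxE mulr_suml.
rewrite exchange_big; apply: eq_bigr => s _; under eq_bigr do rewrite mulr_suml.
rewrite exchange_big; apply: eq_bigr => r _; rewrite -sum_entry_row !mulr_sumr.
apply: eq_bigr => l' _; rewrite /cgY.
by case: (ci (q + s)) => [|c] /=; rewrite ?eqSS; bring.
Qed.

Lemma minorXr l j : (X *m minorX) l j = \sum_(s < i) \sum_(r < i) G s r *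
  ((cb (q + s) == (rb (p + r)).+1)%:R *
   (((ri (p + r)).+1 == j)%:R * e l (ci (q + s)))).
Proof.
rewrite mxE; under eq_bigr do rewrite mxE mulr_sumr.
rewrite exchange_big; apply: eq_bigr => s _; under eq_bigr do rewrite mulr_sumr.
rewrite exchange_big; apply: eq_bigr => r _; rewrite -sum_entry_col !mulr_sumr.
by apply: eq_bigr => l' _; rewrite /cgX; ring.
Qed.

Lemma minorYr l j : (X *m minorY) l j = \sum_(s < i) \sum_(r < i) G s r *
  ((cb (q + s) == rb (p + r))%:R *
   ((ri (p + r) == j)%:R * ((0 < ci (q + s))%:R * e l (ci (q + s)).-1))).
Proof.
rewrite mxE; under eq_bigr do rewrite mxE mulr_sumr.
rewrite exchange_big; apply: eq_bigr => s _; under eq_bigr do rewrite mulr_sumr.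
rewrite exchange_big; apply: eq_bigr => r _; rewrite -sum_entry_col !mulr_sumr.
by apply: eq_bigr => l' _; rewrite /cgY; ring.
Qed.

Lemma cgU_block h c j : (j < n.+1)%N ->
  u h (c * n.+1 + j) = (c == (rb h).+1)%:R * e (ri h).+1 j
     + (c == rb h)%:R * ((0 < j)%:R * e (ri h) j.-1).
Proof.
move=> lt_j; rewrite /cgU /cgX /cgY divnMDl // modnMDl (modn_small lt_j).
by rewrite (divn_small lt_j) addn0.
Qed.

Lemma cgU_block_row c j k : (j < n.-1)%N ->
  u (c * n.-1 + j) k = (cb k == c.+1)%:R * e j.+1 (ci k)
     + (cb k == c)%:R * ((0 < ci k)%:R * e j (ci k).-1).
Proof.
move=> lt_j; have m_gt0 : (0 < n.-1)%N by lia.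
rewrite /cgU /cgX /cgY divnMDl // modnMDl (modn_small lt_j).
by rewrite (divn_small lt_j) addn0.
Qed.

(** For [l = 0] the [Y] part is zero on both sides; for [l > 0] the bound [l <= j] makes [j]
    positive. When [j = 0 < l], [gamma_minus] would lose [Y] terms that the right-hand side may
    contain. *)
Lemma gradL_lower_sum (j l : 'I_n) : (l <= j)%N ->
  gradL X minorX minorY j l = \sum_(s < i) (ci (q + s) == j)%:R *
     adjU u p q s (cb (q + s) * n.+1 + l).
Proof.
move=> le_lj; have lt_l := ltn_ord l.
rewrite /gradL mxE minorXl gamma_minusE.
transitivity (\sum_(s < i) \sum_(r < i) G s r *
  ((cb (q + s) == (rb (p + r)).+1)%:R *
   ((ci (q + s) == j)%:R * e (ri (p + r)).+1 l)) +
  \sum_(s < i) \sum_(r < i) G s r *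
  ((cb (q + s) == rb (p + r))%:R *
   ((ci (q + s) == j)%:R * ((0 < l)%:R * e (ri (p + r)) l.-1)))).
  congr (_ + _); case: (ltnP 0 l) => [l0|l0]; last first.
    rewrite andbF big1 // => s _; rewrite big1 // => r _.
    by bring.
  have j0 : (0 < j)%N by lia.
  have lt_l1 : (l.-1 < n)%N by lia.
  have lt_j1 : (j.-1 < n)%N by have := ltn_ord j; lia.
  rewrite j0 -[j.-1]/(val (Ordinal lt_j1)) -[l.-1]/(val (Ordinal lt_l1)) entryE.
  rewrite minorYl /= prednK //; apply: eq_bigr => s _; apply: eq_bigr => r _.
  by bring.
rewrite -big_split; apply: eq_bigr => s _; rewrite -big_split /adjU mulr_sumr.
by apply: eq_bigr => r _; rewrite cgU_block /=; [ring | lia].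
Qed.

Lemma gradL'_upper_sum (j l : 'I_n) : (j <= l)%N ->
  gradL' X minorX minorY j l = \sum_(s < i) (ci (q + s) == j.+1)%:R *
     adjU u p q s (cb (q + s) * n.+1 + l.+1).
Proof.
move=> le_jl; have lt_l := ltn_ord l.
rewrite /gradL' mxE minorYl gamma_plusE.
transitivity (\sum_(s < i) \sum_(r < i) G s r *
  ((cb (q + s) == (rb (p + r)).+1)%:R *
   ((ci (q + s) == j.+1)%:R * e (ri (p + r)).+1 l.+1)) +
  \sum_(s < i) \sum_(r < i) G s r *
  ((cb (q + s) == rb (p + r))%:R *
   ((ci (q + s) == j.+1)%:R * e (ri (p + r)) l))).
  congr (_ + _); have [lt_l1|le_l1] := ltnP l.+1 n; last first.
    rewrite entry_out ?le_l1 ?orbT // big1 // => s _; rewrite big1 // => r _.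
    by rewrite entry_out ?le_l1 ?orbT //; ring.
  have lt_j1 : (j.+1 < n)%N by lia.
  by rewrite -[j.+1]/(val (Ordinal lt_j1)) -[l.+1]/(val (Ordinal lt_l1)) entryE minorXl.
rewrite -big_split; apply: eq_bigr => s _; rewrite -big_split /adjU mulr_sumr.
by apply: eq_bigr => r _; rewrite cgU_block //=; bring.
Qed.

Lemma gradR_lower_sum (l j : 'I_n) : (j <= l)%N ->
  gradR X minorX minorY l j = \sum_(r < i) ((ri (p + r)).+1 == j)%:R *
     Uadj u p q (rb (p + r) * n.-1 + l.-1) r.
Proof.
move=> le_jl; rewrite /gradR mxE minorXr gamma_minusE.
have [j0|j0] := posnP j.
  rewrite andbF addr0 [RHS]big1; last by move=> r _; rewrite j0 mul0r.
  by rewrite big1 // => s _; rewrite big1 // => r _; rewrite j0 /=; bring.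
have l0 : (0 < l)%N by lia.
have lt_l1 : (l.-1 < n)%N by have := ltn_ord l; lia.
have lt_j1 : (j.-1 < n)%N by have := ltn_ord j; lia.
have -> : entry (X *m minorY) l.-1 j.-1 =
          (X *m minorY) (Ordinal lt_l1) (Ordinal lt_j1) by rewrite -entryE.
rewrite l0 /= minorYr /= -big_split [RHS](eq_bigr (fun r : 'I_i => \sum_(s < i)
   ((ri (p + r)).+1 == j)%:R * (u (rb (p + r) * n.-1 + l.-1) (q + s) * G s r))); last first.
  by move=> r _; rewrite /Uadj mulr_sumr.
rewrite [RHS]exchange_big; apply: eq_bigr => s _; rewrite -big_split.
apply: eq_bigr => r _; rewrite cgU_block_row; last by have := ltn_ord l; lia.
rewrite (_ : (ri (p + r) == j.-1) = ((ri (p + r)).+1 == j)) /= ?prednK //; last by lia.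
by ring.
Qed.

Lemma gradR'_upper_sum (l j : 'I_n) : (l <= j)%N ->
  gradR' X minorX minorY l j = \sum_(r < i) (ri (p + r) == j)%:R *
     Uadj u p q (rb (p + r) * n.-1 + l) r.
Proof.
move=> le_lj; rewrite /gradR' mxE minorYr gamma_plusE.
have ri_lt h : (ri h < n.-1)%N by rewrite ltn_mod; lia.
have [lt_j1|le_j1] := ltnP j.+1 n; last first.
  have riF h : (ri h == j) = false by have := ri_lt h; lia.
  rewrite entry_out ?le_j1 ?orbT // add0r [RHS]big1; last first.
    by move=> r _; rewrite riF mul0r.
  by rewrite big1 // => s _; rewrite big1 // => r _; rewrite riF; bring.
have lt_l1 : (l.+1 < n)%N by lia.
rewrite -[j.+1]/(val (Ordinal lt_j1)) -[l.+1]/(val (Ordinal lt_l1)).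
rewrite entryE minorXr -big_split [RHS](eq_bigr (fun r : 'I_i => \sum_(s < i)
   (ri (p + r) == j)%:R * (u (rb (p + r) * n.-1 + l) (q + s) * G s r))); last first.
  by move=> r _; rewrite /Uadj mulr_sumr.
rewrite [RHS]exchange_big; apply: eq_bigr => s _; rewrite -big_split.
apply: eq_bigr => r _; rewrite cgU_block_row /= ?eqSS; last by lia.
by ring.
Qed.

Lemma sum_minorXl (w : nat -> F) : \sum_(j < n) w j * (minorX *m X) j j =
  \sum_(s < i) \sum_(r < i) G s r * (w (ci (q + s)) * cgX n e (p + r) (q + s)).
Proof.
under eq_bigr do rewrite minorXl mulr_sumr.
rewrite exchange_big; apply: eq_bigr => s _.
under eq_bigr do rewrite mulr_sumr.
rewrite exchange_big; apply: eq_bigr => r _.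
transitivity (G s r * ((cb (q + s) == (rb (p + r)).+1)%:R *
   \sum_(j < n) (ci (q + s) == j)%:R * (w j * e (ri (p + r)).+1 j))).
  by rewrite !mulr_sumr; apply: eq_bigr => j _; ring.
congr (_ * _); rewrite /cgX mulrCA; congr (_ * _).
have [lt_c|le_c] := ltnP (ci (q + s)) n; last first.
  rewrite entry_out ?le_c ?orbT // mulr0 big1 // => j _.
  by rewrite (_ : (_ == _) = false) ?mul0r //; have := ltn_ord j; lia.
rewrite -[RHS](sum_delta (Ordinal lt_c) (fun j => w j * e (ri (p + r)).+1 j)).
by apply: eq_bigr => j _; rewrite -val_eqE eq_sym.
Qed.

(** [w] is read at the position in the block, one more than the column in [Y]. So the weight [j.+1]
    of [D_mx] is [w j = j] here but [w j = j.+1] for [minorX], and the discrepancy counts entries of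
    [X] blocks. *)
Lemma sum_minorYl (w : nat -> F) : \sum_(j < n) w j.+1 * (minorY *m X) j j =
  \sum_(s < i) \sum_(r < i) G s r * (w (ci (q + s)) * cgY n e (p + r) (q + s)).
Proof.
under eq_bigr do rewrite minorYl mulr_sumr.
rewrite exchange_big; apply: eq_bigr => s _.
under eq_bigr do rewrite mulr_sumr.
rewrite exchange_big; apply: eq_bigr => r _.
transitivity (G s r * ((cb (q + s) == rb (p + r))%:R *
   \sum_(j < n) (ci (q + s) == j.+1)%:R * (w j.+1 * e (ri (p + r)) j))).
  by rewrite !mulr_sumr; apply: eq_bigr => j _; ring.
congr (_ * _); rewrite /cgY mulrCA; congr (_ * _).
case cE : (ci (q + s)) (ltn_pmod (q + s) (ltn0Sn n)) => [|c] lt_c.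
  by rewrite big1 => [|j _]; rewrite /= ?mul0r ?mulr0.
have lt_c' : (c < n)%N by lia.
rewrite mul1r -[RHS](sum_delta (Ordinal lt_c') (fun j => w j.+1 * e (ri (p + r)) j)).
by apply: eq_bigr => j _; rewrite -val_eqE eqSS eq_sym.
Qed.

Lemma sum_minorXr (w : nat -> F) : \sum_(j < n) w j * (X *m minorX) j j =
  \sum_(s < i) \sum_(r < i) G s r * (w (ri (p + r)).+1 * cgX n e (p + r) (q + s)).
Proof.
under eq_bigr do rewrite minorXr mulr_sumr.
rewrite exchange_big; apply: eq_bigr => s _.
under eq_bigr do rewrite mulr_sumr.
rewrite exchange_big; apply: eq_bigr => r _.
transitivity (G s r * ((cb (q + s) == (rb (p + r)).+1)%:R *
   \sum_(j < n) ((ri (p + r)).+1 == j)%:R * (w j * e j (ci (q + s))))).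
  by rewrite !mulr_sumr; apply: eq_bigr => j _; ring.
congr (_ * _); rewrite /cgX mulrCA; congr (_ * _).
have lt_r : ((ri (p + r)).+1 < n)%N by have := @ltn_pmod (p + r) n.-1; lia.
rewrite -[RHS](sum_delta (Ordinal lt_r) (fun j => w j * e j (ci (q + s)))).
by apply: eq_bigr => j _; rewrite -val_eqE eq_sym.
Qed.

Lemma sum_minorYr (w : nat -> F) : \sum_(j < n) w j * (X *m minorY) j j =
  \sum_(s < i) \sum_(r < i) G s r * (w (ri (p + r)) * cgY n e (p + r) (q + s)).
Proof.
under eq_bigr do rewrite minorYr mulr_sumr.
rewrite exchange_big; apply: eq_bigr => s _.
under eq_bigr do rewrite mulr_sumr.
rewrite exchange_big; apply: eq_bigr => r _.
transitivity (G s r * ((cb (q + s) == rb (p + r))%:R *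
   \sum_(j < n) (ri (p + r) == j)%:R *
     (w j * ((0 < ci (q + s))%:R * e j (ci (q + s)).-1)))).
  by rewrite !mulr_sumr; apply: eq_bigr => j _; ring.
congr (_ * _); rewrite /cgY mulrCA; congr (_ * _).
have lt_r : (ri (p + r) < n)%N by have := @ltn_pmod (p + r) n.-1; lia.
rewrite -[RHS](sum_delta (Ordinal lt_r)
  (fun j => w j * ((0 < ci (q + s))%:R * e j (ci (q + s)).-1))).
by apply: eq_bigr => j _; rewrite -val_eqE eq_sym.
Qed.

End BandMinor.

Lemma shift_minor (F : fieldType) n (X : 'M[F]_n) p q i t : (1 < n)%N ->
  minorX X (p + t * n.-1) (q + t * n.+1) i = minorX X p q i /\
  minorY X (p + t * n.-1) (q + t * n.+1) i = minorY X p q i.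
Proof.
move=> n_gt1; split; apply/matrixP => j l; rewrite !mxE shift_window //.
  by apply: eq_bigr => s _; apply: eq_bigr => r _; rewrite shift_cgX.
by apply: eq_bigr => s _; apply: eq_bigr => r _; rewrite shift_cgY.
Qed.

(** * Weights of the minors ending with a block *)

Section BandMinorGraded.

Variables (F : fieldType) (n p q i L eps : nat).
Hypothesis n_gt1 : (1 < n)%N.
Hypothesis eps_le1 : (eps <= 1)%N.
Hypothesis row_end : (p + i = L * n.-1)%N.
Hypothesis col_end : (q + i = L * n.+1 + eps)%N.

Local Notation rb h := (h %/ n.-1)%N.
Local Notation ri h := (h %% n.-1)%N.
Local Notation cb k := (k %/ n.+1)%N.
Local Notation ci k := (k %% n.+1)%N.

(** [degX] is the degree of the minor in the entries of the [X] blocks; it appears because [D_mx]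
    weighs such an entry by one more than an entry of a [Y] block. *)
Definition minor_weights : weights F n :=
  let degX := \sum_(s < i) (cb (q + s))%:R - \sum_(r < i) (rb (p + r))%:R in
  Weights (fun j => \sum_(s < i) (ci (q + s) == j)%:R)
    (fun j => \sum_(s < i) (ci (q + s) == j.+1)%:R)
    (fun j => \sum_(r < i) ((ri (p + r)).+1 == j)%:R)
    (fun j => \sum_(r < i) (ri (p + r) == j)%:R)
    i%:R (\sum_(s < i) (ci (q + s))%:R + degX)
    (\sum_(r < i) (ri (p + r)).+1%:R + degX).

Variable X : 'M[F]_n.

Local Notation e := (entry X).
Local Notation u := (cgU n e).
Local Notation G := (\adj (window u p q i)).
Local Notation f := (\det (window u p q i)).
Local Notation GX := (minorX X p q i).
Local Notation GY := (minorY X p q i).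

(** Position [l] of the same block is not left of [q + s] and, as the window ends with a complete
    block, still inside it. A column at position 0 may be the extra last one, so there only [l = 0]
    is allowed. *)
Lemma adjU_block (s : 'I_i) l : (ci (q + s) <= l <= n)%N ->
  (ci (q + s) == l) || (0 < ci (q + s))%N ->
  adjU u p q s (cb (q + s) * n.+1 + l) = f * (ci (q + s) == l)%:R.
Proof.
set c := cb (q + s); set j := ci (q + s) => /andP[le_jl le_ln] j_l.
have qsE : (q + s = c * n.+1 + j)%N by exact: divn_eq.
have lt_s := ltn_ord s.
have lt_k : (c * n.+1 + l < q + i)%N.
  have [lt_cL|le_Lc] := ltnP c L.
    have : (c.+1 * n.+1 <= L * n.+1)%N by rewrite leq_mul2r lt_cL orbT.
    by rewrite mulSn; lia.
  have : (L * n.+1 <= c * n.+1)%N by rewrite leq_mul2r le_Lc orbT.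
  by case/orP: j_l => [/eqP <-|]; lia.
have lt_s' : (s + (l - j) < i)%N by lia.
have -> : (c * n.+1 + l = q + Ordinal lt_s')%N by rewrite /=; lia.
rewrite adjU_window -val_eqE /=; congr (_ * _%:R); congr nat_of_bool.
by lia.
Qed.

Lemma Uadj_block (r : 'I_i) l : (ri (p + r) <= l < n.-1)%N ->
  Uadj u p q (rb (p + r) * n.-1 + l) r = f * (ri (p + r) == l)%:R.
Proof.
set c := rb (p + r); set j := ri (p + r) => /andP[le_jl lt_ln].
have prE : (p + r = c * n.-1 + j)%N by exact: divn_eq.
have lt_r := ltn_ord r.
have lt_k : (c * n.-1 + l < p + i)%N.
  have lt_cL : (c < L)%N.
    rewrite ltnNge; apply/negP => le_Lc.
    have : (L * n.-1 <= c * n.-1)%N by rewrite leq_mul2r le_Lc orbT.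
    by lia.
  have : (c.+1 * n.-1 <= L * n.-1)%N by rewrite leq_mul2r lt_cL orbT.
  by rewrite mulSn; lia.
have lt_r' : (r + (l - j) < i)%N by lia.
have -> : (c * n.-1 + l = p + Ordinal lt_r')%N by rewrite /=; lia.
rewrite Uadj_window -val_eqE /=; congr (_ * _%:R); congr nat_of_bool.
by lia.
Qed.

Lemma sum_adj_cgU : \sum_(s < i) \sum_(r < i) G s r * u (p + r) (q + s) = f * i%:R.
Proof.
transitivity (\sum_(s < i) f); last by rewrite sumr_const card_ord mulr_natr.
apply: eq_bigr => s _; rewrite -[RHS]mulr1.
by rewrite -[\sum_(r < i) _]/(adjU u p q s (q + s)) adjU_window eqxx.
Qed.

Lemma sum_col_adj (w : nat -> F) :
  \sum_(s < i) \sum_(r < i) G s r * (w (q + s) * u (p + r) (q + s)) =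
  f * \sum_(s < i) w (q + s).
Proof.
rewrite mulr_sumr; apply: eq_bigr => s _.
have := adjU_window u p q s s; rewrite eqxx mulr1 => <-.
by rewrite /adjU mulr_suml; apply: eq_bigr => r _; ring.
Qed.

Lemma sum_row_adj (w : nat -> F) :
  \sum_(s < i) \sum_(r < i) G s r * (w (p + r) * u (p + r) (q + s)) =
  f * \sum_(r < i) w (p + r).
Proof.
rewrite exchange_big mulr_sumr; apply: eq_bigr => r _.
have := Uadj_window u p q r r; rewrite eqxx mulr1 => <-.
by rewrite /Uadj mulr_suml; apply: eq_bigr => s _; ring.
Qed.

(** Euler's identity for the [X] blocks: at a nonzero entry, block column minus block row is 1 in an
    [X] block and 0 in a [Y] block. *)
Lemma sum_adj_cgX :
  \sum_(s < i) \sum_(r < i) G s r * cgX n e (p + r) (q + s) =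
  f * (\sum_(s < i) (cb (q + s))%:R - \sum_(r < i) (rb (p + r))%:R).
Proof.
rewrite mulrBr -(sum_col_adj (fun k => (cb k)%:R)) -(sum_row_adj (fun h => (rb h)%:R)).
rewrite -sumrB; apply: eq_bigr => s _; rewrite -sumrB; apply: eq_bigr => r _.
rewrite /cgU /cgX /cgY.
case: eqP => [->|_]; first by rewrite (_ : (_.+1 == _) = false); [bring | lia].
by case: eqP => [->|_]; bring.
Qed.

Lemma trace_D_mx (A : 'M[F]_n) : \tr (D_mx F n *m A) = \sum_(j < n) j.+1%:R * A j j.
Proof.
by apply: eq_bigr => j _; rewrite mul_diag_mx !mxE.
Qed.

Lemma graded_minor : graded_at minor_weights X GX GY f.
Proof.
have lt_ci k : (ci k < n.+1)%N by rewrite ltn_mod.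
have lt_ri h : (ri h < n.-1)%N by rewrite ltn_mod; lia.
split => /=.
- move=> j; rewrite gradL_lower_sum // mulr_sumr; apply: eq_bigr => s _.
  case: eqP => [E|_]; last by bring.
  by rewrite adjU_block ?E ?eqxx //; [bring | have := ltn_ord j; lia].
- move=> j l lt_jl; rewrite gradL'_upper_sum //; last exact: ltnW.
  rewrite big1 // => s _.
  case: eqP => [E|_]; last by bring.
  rewrite adjU_block ?E ?orbT //; last by have := ltn_ord l; lia.
  by rewrite (_ : (_ == _) = false); [bring | lia].
- move=> j; rewrite gradL'_upper_sum // mulr_sumr; apply: eq_bigr => s _.
  case: eqP => [E|_]; last by bring.
  by rewrite adjU_block ?E ?eqxx //; [bring | have := ltn_ord j; lia].
- move=> l j lt_jl; rewrite gradR_lower_sum //; last exact: ltnW.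
  rewrite big1 // => r _.
  case: eqP => [E|_]; last by bring.
  rewrite Uadj_block; last by have := ltn_ord l; lia.
  by rewrite (_ : (_ == _) = false); [bring | lia].
- move=> l; rewrite gradR_lower_sum // mulr_sumr; apply: eq_bigr => r _.
  case: eqP => [E|_]; last by bring.
  rewrite Uadj_block; last by have := ltn_ord l; lia.
  by rewrite (_ : (_ == _) = true); [bring | lia].
- move=> l; rewrite gradR'_upper_sum // mulr_sumr; apply: eq_bigr => r _.
  case: eqP => [E|_]; last by bring.
  rewrite Uadj_block ?E ?eqxx; first by bring.
  by rewrite leqnn -E lt_ri.
- rewrite mulmxDl mxtraceD -sum_adj_cgU.
  have trE (A : 'M[F]_n) : \tr A = \sum_(j < n) 1 * A j j.
    by apply: eq_bigr => j _; rewrite mul1r.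
  rewrite !trE (sum_minorXl _ _ _ _ n_gt1 (fun=> 1))
    (sum_minorYl _ _ _ _ n_gt1 (fun=> 1)).
  rewrite -big_split; apply: eq_bigr => s _; rewrite -big_split.
  by apply: eq_bigr => r _ /=; rewrite /cgU; ring.
- rewrite mulmxDl mulmxDr mxtraceD !trace_D_mx mulrDr -sum_adj_cgX.
  rewrite (sum_minorXl _ _ _ _ n_gt1 (fun j => j.+1%:R))
    (sum_minorYl _ _ _ _ n_gt1 (fun j => j%:R)).
  rewrite -(sum_col_adj (fun k => (ci k)%:R)) -!big_split; apply: eq_bigr => s _.
  rewrite -!big_split; apply: eq_bigr => r _ /=.
  by rewrite /cgU -natr1; ring.
- rewrite mulmxDr mulmxDr mxtraceD !trace_D_mx mulrDr -sum_adj_cgX.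
  rewrite (sum_minorXr _ _ _ _ n_gt1 (fun j => j.+1%:R))
    (sum_minorYr _ _ _ _ n_gt1 (fun j => j.+1%:R)).
  rewrite -(sum_row_adj (fun h => (ri h).+1%:R)) -!big_split; apply: eq_bigr => s _.
  rewrite -!big_split; apply: eq_bigr => r _ /=.
  by rewrite /cgU -natr1; ring.
Qed.

End BandMinorGraded.

(** * Pairs of minors *)

(** Used from right to left: a term blind to block numbers becomes a sum over shifts [t], exactly
    one of which contributes. *)
Lemma sum_shift (R : comNzRingType) T a b (F : nat -> R) : (b <= a < b + T)%N ->
  \sum_(t < T) (a == b + t)%N%:R * F t = F (a - b)%N.
Proof.
move=> /andP[le_ba lt_a]; have lt_t : (a - b < T)%N by lia.
rewrite -[RHS](sum_delta (Ordinal lt_t) (fun t => F t)).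
apply: eq_bigr => t _; rewrite -val_eqE /=; congr (_%:R * _); congr nat_of_bool.
by lia.
Qed.

Lemma shift_bounds k a b : (b <= k)%N -> (k <= a <= k.*2)%N ->
  (b <= a < b + k.*2.+1)%N.
Proof. by lia. Qed.

(** The Kronecker factors force [j = a s] and [l = b z]. Positions outside the range, such as the
    last column [n] of a block, are absent on the left, hence the vanishing hypothesis. *)
Lemma masked_trace (R : comNzRingType) n (rel : nat -> nat -> bool)
    (I J : finType) (a : I -> nat) (alpha : I -> nat -> R)
    (b : J -> nat) (beta : J -> nat -> R) :
  (forall s z, rel (b z) (a s) -> (n <= a s)%N || (n <= b z)%N -> beta z (a s) = 0) ->
  \sum_(j < n) \sum_(l < n) (rel l j)%:R *
     ((\sum_s (a s == j)%:R * alpha s l) * (\sum_z (b z == l)%:R * beta z j)) =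
  \sum_z \sum_s (rel (b z) (a s))%:R * (alpha s (b z) * beta z (a s)).
Proof.
move=> out0.
transitivity (\sum_z \sum_s \sum_(j < n) \sum_(l < n)
    (a s == j)%:R * ((b z == l)%:R * ((rel l j)%:R * (alpha s l * beta z j)))).
  rewrite (eq_bigr (fun j : 'I_n => \sum_z \sum_s \sum_(l < n)
    (a s == j)%:R * ((b z == l)%:R * ((rel l j)%:R * (alpha s l * beta z j))))).
    by rewrite exchange_big; apply: eq_bigr => z _; rewrite exchange_big.
  move=> j _; rewrite (eq_bigr (fun l : 'I_n => \sum_z \sum_s
    (a s == j)%:R * ((b z == l)%:R * ((rel l j)%:R * (alpha s l * beta z j))))).
    by rewrite exchange_big; apply: eq_bigr => z _; rewrite exchange_big.
  move=> l _; rewrite mulr_sumr mulr_sumr; apply: eq_bigr => z _.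
  by rewrite mulr_suml mulr_sumr; apply: eq_bigr => s _; ring.
apply: eq_bigr => z _; apply: eq_bigr => s _.
have [/andP[lt_a lt_b]|] := boolP ((a s < n)%N && (b z < n)%N); last first.
  rewrite negb_and -!leqNgt => out.
  rewrite big1 => [|j _]; last first.
    rewrite big1 // => l _; case: eqP => [aj|_]; last by bring.
    case: eqP => [bl|_]; last by bring.
    by have := ltn_ord j; have := ltn_ord l; case/orP: out; lia.
  by case r_ba : (rel _ _); [rewrite out0 ?r_ba //; bring | bring].
rewrite -(sum_delta (Ordinal lt_a) (fun j =>
  (rel (b z) j)%:R * (alpha s (b z) * beta z j))).
apply: eq_bigr => j _; rewrite -mulr_sumr -val_eqE /= eq_sym; congr (_ * _).
rewrite -(sum_delta (Ordinal lt_b) (fun l =>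
  (rel l j)%:R * (alpha s l * beta z j))).
by apply: eq_bigr => l _; rewrite -val_eqE /= eq_sym.
Qed.

(* The first minor is moved down by [k] blocks, which changes nothing, so that all
   relative shifts of the second minor are natural numbers [t <= 2k]. *)
Section BandMinorPair.

Variables (F : fieldType) (n k p q i eps p' q' i' eps' : nat).
Hypothesis n_gt1 : (1 < n)%N.
Hypothesis eps_le1 : (eps <= 1)%N.
Hypothesis eps'_le1 : (eps' <= 1)%N.
Hypothesis row_end : (p + i = k.*2 * n.-1)%N.
Hypothesis col_end : (q + i = k.*2 * n.+1 + eps)%N.
Hypothesis row_end' : (p' + i' = k * n.-1)%N.
Hypothesis col_end' : (q' + i' = k * n.+1 + eps')%N.
Hypothesis p_ge : (k * n.-1 <= p)%N.
Hypothesis q_ge : (k * n.+1 <= q)%N.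
Hypothesis le_i : (i' <= i)%N.

Variable X : 'M[F]_n.

Local Notation rb h := (h %/ n.-1)%N.
Local Notation ri h := (h %% n.-1)%N.
Local Notation cb k := (k %/ n.+1)%N.
Local Notation ci k := (k %% n.+1)%N.
Local Notation e := (entry X).
Local Notation u := (cgU n e).
Local Notation f := (\det (window u p q i)).
Local Notation g := (\det (window u p' q' i')).
Local Notation H := (\adj (window u p' q' i')).
Local Notation GX := (minorX X p q i).
Local Notation GY := (minorY X p q i).
Local Notation GX' := (minorX X p' q' i').
Local Notation GY' := (minorY X p' q' i').
Local Notation sh t := (p' + t * n.-1)%N.
Local Notation sc t := (q' + t * n.+1)%N.

Lemma bandXE h l : bandX n.-1 n.+1 u h l = cgX n e h l.
Proof.
rewrite /bandX /cgU /cgX /cgY; case: eqP => [->|_]; last by bring.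
by rewrite (_ : (_.+1 == _) = false); [bring | lia].
Qed.

Lemma bandYE h l : bandY n.-1 n.+1 u h l = cgY n e h l.
Proof.
rewrite /bandY /cgU /cgX /cgY; case: eqP => [->|_]; last by bring.
by rewrite (_ : (_ == _.+1) = false); [bring | lia].
Qed.

Lemma rb_bounds (r : 'I_i) : (k <= rb (p + r) < k.*2)%N.
Proof.
have lt_r := ltn_ord r; have m_gt0 : (0 < n.-1)%N by lia.
by apply/andP; split; [rewrite leq_divRL // | rewrite ltn_divLR //]; lia.
Qed.

Lemma cb_bounds (s : 'I_i) : (k <= cb (q + s) <= k.*2)%N.
Proof.
have lt_s := ltn_ord s.
apply/andP; split; first by rewrite leq_divRL //; lia.
by rewrite -ltnS ltn_divLR // mulSn; lia.
Qed.

Lemma rb_bounds' (r : 'I_i') : (rb (p' + r) < k)%N.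
Proof. by have lt_r := ltn_ord r; rewrite ltn_divLR; lia. Qed.

Lemma cb_bounds' (s : 'I_i') : (cb (q' + s) <= k)%N.
Proof. by have lt_s := ltn_ord s; rewrite -ltnS ltn_divLR // mulSn; lia. Qed.

Lemma sum_term_diag (r' s' : 'I_i') :
  \sum_(t < k.*2.+1) term_diag n.-1 n.+1 u p q i (sh t + r') (sc t + s') =
  f * \sum_(r < i) ((ri (p + r)).+1 == (ri (p' + r')).+1)%:R *
     cgX n e (p' + r') (q' + s').
Proof.
rewrite /term_diag exchange_big mulr_sumr; apply: eq_bigr => r _.
have le_r : (k <= rb (p + r) <= k.*2)%N by case/andP: (rb_bounds r) => ->; apply: ltnW.
have le_r' := ltnW (rb_bounds' r').
rewrite -(sum_shift (T := k.*2.+1) (a := rb (p + r)) (b := rb (p' + r'))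
  (fun=> f * (((ri (p + r)).+1 == (ri (p' + r')).+1)%:R *
    cgX n e (p' + r') (q' + s')))); last exact: shift_bounds.
apply: eq_bigr => t _; rewrite bandXE shift_cgX // eqSS.
suff -> : (p + r == sh t + r')%N =
    (rb (p + r) == rb (p' + r') + t)%N && (ri (p + r) == ri (p' + r')).
  by rewrite -mulnb natrM; ring.
apply/eqP/andP => [->|[/eqP rbE /eqP riE]].
  by rewrite (shift_rb n_gt1) shift_ri !eqxx.
by rewrite (divn_eq (p + r) n.-1) (divn_eq (sh t + r') n.-1) (shift_rb n_gt1) shift_ri rbE riE.
Qed.

(** [gradR] is triangular, so the first minor enters only through [f] and the counts of its rows at
    each position; this is the source of [term_diag]. *)
Lemma trace_lower_gradR :
  \tr (lower_part (gradR X GX GY) *m (X *m GX')) =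
  \sum_(s' < i') \sum_(r' < i') H s' r' *
    \sum_(t < k.*2.+1) term_diag n.-1 n.+1 u p q i (sh t + r') (sc t + s').
Proof.
have grf := graded_minor n_gt1 eps_le1 row_end col_end X.
rewrite trace_lower_diag; last exact: gradR_lower grf.
under eq_bigr do rewrite (gradR_diag grf) -mulrA.
rewrite -mulr_sumr /= (sum_minorXr _ _ _ _ n_gt1
  (fun j => \sum_(r < i) ((ri (p + r)).+1 == j)%:R)) mulr_sumr.
apply: eq_bigr => s' _; rewrite mulr_sumr; apply: eq_bigr => r' _.
by rewrite sum_term_diag -mulr_suml; ring.
Qed.

(** The sum over [t] absorbs the block mask; within one block, comparing columns is comparing
    positions. *)
Lemma sum_term_lower (r' s' : 'I_i') :
  \sum_(t < k.*2.+1) term_lower n.-1 n.+1 u p q i (sh t + r') (sc t + s') =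
  \sum_(s < i) (ci (q' + s') <= ci (q + s))%N%:R *
    (adjU u p q s (cb (q + s) * n.+1 + ci (q' + s')) *
      ((cb (q' + s') == (rb (p' + r')).+1)%:R * e (ri (p' + r')).+1 (ci (q + s)))).
Proof.
rewrite /term_lower exchange_big; apply: eq_bigr => s _.
have le_s := cb_bounds s; have le_s' := cb_bounds' s'.
rewrite -(sum_shift (T := k.*2.+1) (a := cb (q + s)) (b := cb (q' + s'))
  (fun=> (ci (q' + s') <= ci (q + s))%N%:R *
    (adjU u p q s (cb (q + s) * n.+1 + ci (q' + s')) *
      ((cb (q' + s') == (rb (p' + r')).+1)%:R * e (ri (p' + r')).+1 (ci (q + s))))));
  last exact: shift_bounds.
apply: eq_bigr => t _; rewrite shift_cb; case: eqP => [cE|_]; last by bring.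
have scE : (sc t + s' = cb (q + s) * n.+1 + ci (q' + s'))%N.
  by rewrite (divn_eq (sc t + s') n.+1) shift_cb shift_ci cE.
rewrite bandXE /cgX (shift_rb n_gt1) shift_ri scE [X in (_ <= X)%N](divn_eq (q + s) n.+1).
by rewrite leq_add2l cE -addSn eqn_add2r; bring.
Qed.

Lemma trace_lower_gradL :
  \tr (lower_part (gradL X GX GY) *m (GX' *m X)) =
  \sum_(s' < i') \sum_(r' < i') H s' r' *
    \sum_(t < k.*2.+1) term_lower n.-1 n.+1 u p q i (sh t + r') (sc t + s').
Proof.
pose beta (z : 'I_i' * 'I_i') (j : nat) := H z.1 z.2 *
  ((cb (q' + z.1) == (rb (p' + z.2)).+1)%:R * e (ri (p' + z.2)).+1 j).
transitivity (\sum_(j < n) \sum_(l < n) (l <= j)%N%:R *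
  ((\sum_(s < i) (ci (q + s) == j)%:R * adjU u p q s (cb (q + s) * n.+1 + l)) *
   (\sum_(z : 'I_i' * 'I_i') (ci (q' + z.1) == l)%:R * beta z j))).
  apply: eq_bigr => j _; rewrite mxE; apply: eq_bigr => l _; rewrite mxE.
  case: leqP => [le_lj|_]; last by bring.
  rewrite mul1r gradL_lower_sum // minorXl; congr (_ * _).
  by rewrite pair_bigA; apply: eq_bigr => z _; rewrite /beta /=; ring.
rewrite (@masked_trace _ n leq _ _ (fun s : 'I_i => ci (q + s))
  (fun s l => adjU u p q s (cb (q + s) * n.+1 + l))
  (fun z : 'I_i' * 'I_i' => ci (q' + z.1)) beta); last first.
  move=> s z /= le_ba out; rewrite /beta entry_out ?mulr0 //.
  by apply/orP; right; lia.
rewrite [RHS]pair_bigA /=; apply: eq_bigr => z _; rewrite sum_term_lower mulr_sumr.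
by apply: eq_bigr => s _; rewrite /beta; ring.
Qed.

Lemma sum_term_upper (r' s' : 'I_i') :
  \sum_(t < k.*2.+1) term_upper n.-1 n.+1 u p q i (sh t + r') (sc t + s') =
  \sum_(r < i) (ri (p' + r') < ri (p + r))%N%:R *
    (Uadj u p q (rb (p + r) * n.-1 + ri (p' + r')) r *
      ((cb (q' + s') == rb (p' + r'))%:R *
        ((0 < ci (q' + s'))%N%:R * e (ri (p + r)) (ci (q' + s')).-1))).
Proof.
rewrite /term_upper exchange_big; apply: eq_bigr => r _.
have le_r : (k <= rb (p + r) <= k.*2)%N by case/andP: (rb_bounds r) => ->; apply: ltnW.
have le_r' := ltnW (rb_bounds' r').
rewrite -(sum_shift (T := k.*2.+1) (a := rb (p + r)) (b := rb (p' + r'))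
  (fun=> (ri (p' + r') < ri (p + r))%N%:R *
    (Uadj u p q (rb (p + r) * n.-1 + ri (p' + r')) r *
      ((cb (q' + s') == rb (p' + r'))%:R *
        ((0 < ci (q' + s'))%N%:R * e (ri (p + r)) (ci (q' + s')).-1)))));
  last exact: shift_bounds.
apply: eq_bigr => t _; rewrite (shift_rb n_gt1) eq_sym; case: eqP => [rE|_]; last by bring.
have shE : (sh t + r' = rb (p + r) * n.-1 + ri (p' + r'))%N.
  by rewrite (divn_eq (sh t + r') n.-1) (shift_rb n_gt1) shift_ri rE.
rewrite bandYE /cgY shift_cb shift_ci shE [X in (_ < X)%N](divn_eq (p + r) n.-1).
by rewrite ltn_add2l rE eqn_add2r; bring.
Qed.

Lemma trace_upper_gradR' :
  \tr (upper_part (gradR' X GX GY) *m (X *m GY')) =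
  \sum_(s' < i') \sum_(r' < i') H s' r' *
    \sum_(t < k.*2.+1) term_upper n.-1 n.+1 u p q i (sh t + r') (sc t + s').
Proof.
have lt_ri h : (ri h < n.-1)%N by rewrite ltn_mod; lia.
pose beta (z : 'I_i' * 'I_i') (j : nat) := H z.1 z.2 *
  ((cb (q' + z.1) == rb (p' + z.2))%:R *
    ((0 < ci (q' + z.1))%N%:R * e j (ci (q' + z.1)).-1)).
transitivity (\sum_(j < n) \sum_(l < n) (l < j)%N%:R *
  ((\sum_(r < i) (ri (p + r) == j)%:R * Uadj u p q (rb (p + r) * n.-1 + l) r) *
   (\sum_(z : 'I_i' * 'I_i') (ri (p' + z.2) == l)%:R * beta z j))).
  rewrite exchange_big; apply: eq_bigr => l _; rewrite mxE.
  apply: eq_bigr => j _; rewrite mxE.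
  case: ltnP => [lt_lj|_]; last by bring.
  rewrite mul1r gradR'_upper_sum //; last exact: ltnW.
  rewrite minorYr; congr (_ * _).
  by rewrite pair_bigA; apply: eq_bigr => z _; rewrite /beta /=; ring.
rewrite (@masked_trace _ n ltn _ _ (fun r : 'I_i => ri (p + r))
  (fun r l => Uadj u p q (rb (p + r) * n.-1 + l) r)
  (fun z : 'I_i' * 'I_i' => ri (p' + z.2)) beta); last first.
  move=> r z _ /= out; have := lt_ri (p + r)%N; have := lt_ri (p' + z.2)%N.
  by case/orP: out; lia.
rewrite [RHS]pair_bigA /=; apply: eq_bigr => z _; rewrite sum_term_upper mulr_sumr.
by apply: eq_bigr => s _; rewrite /beta; ring.
Qed.

Lemma cgU_band h l : (cb l != rb h)%N -> (cb l != (rb h).+1)%N -> u h l = 0.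
Proof.
by move=> /negPf neY /negPf neX; rewrite /cgU /cgX /cgY neX neY; bring.
Qed.

Lemma cgU_below K d h l : (d <= 1)%N -> (K * n.-1 <= h)%N -> (l < K * n.+1 + d)%N ->
  u h l = 0.
Proof.
move=> le_d le_h lt_l; have m_gt0 : (0 < n.-1)%N by lia.
have le_K : (K <= rb h)%N by rewrite leq_divRL.
have le_c : (cb l <= K)%N by rewrite -ltnS ltn_divLR // mulSn; lia.
rewrite /cgU /cgX /cgY (_ : (cb l == (rb h).+1) = false); last by lia.
case: eqP => [cE|_]; last by bring.
have cK : cb l = K by lia.
have : (ci l < 1)%N by move: (divn_eq l n.+1); rewrite cK; lia.
by case: (ci l) => //= _; bring.
Qed.

Lemma cgU_right K d h l : (h < K * n.-1)%N -> (K * n.+1 + d <= l)%N ->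
  cb l <> rb h.
Proof.
move=> lt_h le_l; have m_gt0 : (0 < n.-1)%N by lia.
have : (rb h < K)%N by rewrite ltn_divLR.
have : (K <= cb l)%N by rewrite leq_divRL //; lia.
by lia.
Qed.

Lemma bracket_rest_minors : bracket_rest X GX GY GX' GY' =
  (\sum_(t < k.*2.+1) pair_coef F p q i (sh t) (sc t) i') * (f * g).
Proof.
rewrite /bracket_rest trace_lower_gradR trace_lower_gradL trace_upper_gradR'.
rewrite -!sumrB mulr_suml.
transitivity (\sum_(s' < i') \sum_(r' < i') \sum_(t < k.*2.+1) H s' r' *
    (term_diag n.-1 n.+1 u p q i (sh t + r') (sc t + s')
     - term_lower n.-1 n.+1 u p q i (sh t + r') (sc t + s')
     - term_upper n.-1 n.+1 u p q i (sh t + r') (sc t + s'))).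
  apply: eq_bigr => s' _; rewrite -!sumrB; apply: eq_bigr => r' _.
  by rewrite -!mulrBr -!sumrB mulr_sumr.
under eq_bigr do rewrite exchange_big.
rewrite exchange_big; apply: eq_bigr => t _.
(* Translation by [t] blocks leaves the second minor and its adjugate unchanged, so each [t] is a
   pair of windows of the same [u]. *)
rewrite -(shift_window n_gt1 e p' q' i' t) -(@sum_terms _ n.-1 n.+1 u) //; first exact: cgU_band.
- by move=> h l; rewrite row_end col_end; apply: cgU_below.
- by move=> h l; rewrite row_end col_end; apply: cgU_right.
- move=> h l le_h lt_l; apply: (@cgU_below (k + t) eps') => //.
    by rewrite mulnDl; lia.
  by rewrite mulnDl; lia.
(* For [t < k] the shifted second window ends at least a block earlier, up to its extra column. For
   [t >= k] its last row is not above that of the first, and [i' <= i] then puts its first row at or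
   below [p]. *)
have [lt_t|le_t] := ltnP t k; apply/orP; [left | right].
  have : (t.+1 * n.+1 <= k * n.+1)%N by rewrite leq_mul2r lt_t orbT.
  have kE : (k.*2 * n.+1 = k * n.+1 + k * n.+1)%N by rewrite -addnn mulnDl.
  by rewrite mulSn col_end kE; lia.
have : (k * n.-1 <= t * n.-1)%N by rewrite leq_mul2r le_t orbT.
have kE : (k.*2 * n.-1 = k * n.-1 + k * n.-1)%N by rewrite -addnn mulnDl.
by move: row_end; rewrite kE; lia.
Qed.

End BandMinorPair.

(** * Principal minors and the log-canonical family *)

Section PrincipalMinor.

Variables (F : fieldType) (n p i : nat).
Hypothesis p_end : (p + i = n)%N.

Variable X : 'M[F]_n.

Local Notation e := (entry X).
Local Notation G := (\adj (window e p p i)).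
Local Notation f := (\det (window e p p i)).

Definition cornerG : 'M[F]_n := \matrix_(j, l) \sum_(s < i) \sum_(r < i)
  G s r * ((p + r == l)%N%:R * (p + s == j)%N%:R).

Definition corner_weight (j : nat) : F := \sum_(s < i) (p + s == j)%N%:R.

Definition corner_weights : weights F n :=
  let c := corner_weight in
  Weights (fun j : 'I_n => c j) (fun j : 'I_n => c j.+1) (fun j : 'I_n => c j)
    (fun j : 'I_n => c j.+1) (\sum_(j < n) c j) (\sum_(j < n) j.+1%:R * c j)
    (\sum_(j < n) j.+1%:R * c j).

Lemma cornerGl (j l : 'I_n) :
  (cornerG *m X) j l = \sum_(s < i) (p + s == j)%N%:R * adjU e p p s l.
Proof.
rewrite mxE; under eq_bigr do rewrite mxE mulr_suml.
rewrite exchange_big; apply: eq_bigr => s _; under eq_bigr do rewrite mulr_suml.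
rewrite exchange_big /adjU mulr_sumr; apply: eq_bigr => r _.
by rewrite -sum_entry_row !mulr_sumr; apply: eq_bigr => l' _; ring.
Qed.

Lemma cornerGr (l j : 'I_n) :
  (X *m cornerG) l j = \sum_(r < i) (p + r == j)%N%:R * Uadj e p p l r.
Proof.
rewrite mxE; under eq_bigr do rewrite mxE mulr_sumr.
rewrite exchange_big [RHS](eq_bigr (fun r : 'I_i => \sum_(s < i)
   (p + r == j)%N%:R * (e l (p + s) * G s r))); last first.
  by move=> r _; rewrite /Uadj mulr_sumr.
rewrite [RHS]exchange_big; apply: eq_bigr => s _; under eq_bigr do rewrite mulr_sumr.
rewrite exchange_big; apply: eq_bigr => r _.
by rewrite -sum_entry_col !mulr_suml !mulr_sumr; apply: eq_bigr => l' _; ring.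
Qed.

(** The window reaches the last row and column of [X], so any [l >= j] lies in it as soon as [j]
    does. *)
Lemma cornerG_lower (j l : 'I_n) : (j <= l)%N ->
  (cornerG *m X) j l = f * ((j == l)%:R * corner_weight j).
Proof.
move=> le_jl; rewrite cornerGl /corner_weight !mulr_sumr; apply: eq_bigr => s _.
case: eqP => [sj|_]; last by bring.
have lt_l : (l - p < i)%N by have := ltn_ord l; lia.
have -> : nat_of_ord l = (p + Ordinal lt_l)%N by rewrite /=; lia.
rewrite adjU_window -!val_eqE /= (_ : (nat_of_ord s == l - p)%N = (nat_of_ord j == l)%N).
  by bring.
by lia.
Qed.

Lemma cornerG_upper (l j : 'I_n) : (j <= l)%N ->
  (X *m cornerG) l j = f * ((j == l)%:R * corner_weight j).
Proof.
move=> le_jl; rewrite cornerGr /corner_weight !mulr_sumr; apply: eq_bigr => r _.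
case: eqP => [rj|_]; last by bring.
have lt_l : (l - p < i)%N by have := ltn_ord l; lia.
have -> : nat_of_ord l = (p + Ordinal lt_l)%N by rewrite /=; lia.
rewrite Uadj_window -!val_eqE /= (_ : (l - p == r)%N = (nat_of_ord j == l)%N).
  by bring.
by lia.
Qed.

Lemma gradL0 (A : 'M[F]_n) : gradL X A 0 = A *m X.
Proof. by rewrite /gradL mul0mx linear0 addr0. Qed.

Lemma gradL'0 (A : 'M[F]_n) : gradL' X A 0 = gamma_plus (A *m X).
Proof. by rewrite /gradL' mul0mx addr0. Qed.

Lemma gradR0 (A : 'M[F]_n) : gradR X A 0 = X *m A.
Proof. by rewrite /gradR mulmx0 linear0 addr0. Qed.

Lemma gradR'0 (A : 'M[F]_n) : gradR' X A 0 = gamma_plus (X *m A).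
Proof. by rewrite /gradR' mulmx0 addr0. Qed.

Lemma graded_corner : graded_at corner_weights X cornerG 0 f.
Proof.
have diagL j : (cornerG *m X) j j = f * corner_weight j.
  by rewrite cornerG_lower // eqxx; bring.
have diagR j : (X *m cornerG) j j = f * corner_weight j.
  by rewrite cornerG_upper // eqxx; bring.
have cn j : (n <= j)%N -> corner_weight j = 0.
  move=> le_nj; rewrite /corner_weight big1 // => s _.
  by rewrite (_ : (_ == _) = false) //; have := ltn_ord s; lia.
have traceE (A : 'M[F]_n) : (forall j, A j j = f * corner_weight j) ->
    \tr (D_mx F n *m A) = f * \sum_(j < n) j.+1%:R * corner_weight j.
  move=> AE; rewrite trace_D_mx mulr_sumr; apply: eq_bigr => j _.
  by rewrite AE; ring.
split; rewrite ?addr0 /=.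
- by move=> j; rewrite gradL0.
- move=> j l lt_jl; rewrite gradL'0 gamma_plusE.
  have [lt_l|le_l] := ltnP l.+1 n; last by rewrite entry_out ?le_l ?orbT.
  have lt_j : (j.+1 < n)%N by lia.
  rewrite -[j.+1]/(val (Ordinal lt_j)) -[l.+1]/(val (Ordinal lt_l)) entryE.
  rewrite cornerG_lower /= ?ltnS 1?ltnW // -val_eqE /= eqSS.
  by rewrite (_ : (_ == _) = false); [bring | lia].
- move=> j; rewrite gradL'0 gamma_plusE.
  have [lt_j|le_j] := ltnP j.+1 n; last by rewrite entry_out ?le_j // cn ?mulr0.
  by rewrite -[j.+1]/(val (Ordinal lt_j)) entryE diagL.
- move=> l j lt_jl; rewrite gradR0 cornerG_upper 1?ltnW // -val_eqE.
  by rewrite (_ : (_ == _) = false); [bring | move=> /=; lia].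
- by move=> j; rewrite gradR0.
- move=> j; rewrite gradR'0 gamma_plusE.
  have [lt_j|le_j] := ltnP j.+1 n; last by rewrite entry_out ?le_j // cn ?mulr0.
  by rewrite -[j.+1]/(val (Ordinal lt_j)) entryE diagR.
- by rewrite mulr_sumr; apply: eq_bigr => j _; rewrite diagL.
- exact: traceE.
- exact: traceE.
Qed.

(** As [cornerG *m X] is lower triangular, the first two traces leave minus the strictly upper part
    of [X *m cornerG] against [X *m GX']. By adjointness the third pairs the same part with
    [gamma_minus (X *m GY')]. Together they pair it with the upper triangular [gradR] of the second
    function. *)
Lemma bracket_rest_corner c GX' GY' v : graded_at c X GX' GY' v ->
  bracket_rest X cornerG 0 GX' GY' = 0.
Proof.
move=> gG; rewrite /bracket_rest gradL0 gradR0 gradR'0.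
have -> : lower_part (cornerG *m X) = cornerG *m X.
  apply/matrixP => j l; rewrite [LHS]mxE; case: leqP => // lt_jl.
  by rewrite cornerG_lower 1?ltnW // -val_eqE (_ : (_ == _) = false); [bring | move=> /=; lia].
have -> : \tr (cornerG *m X *m (GX' *m X)) = \tr (X *m cornerG *m (X *m GX')).
  by rewrite !mulmxA [LHS]mxtrace_mulC !mulmxA.
rewrite -[X in _ - \tr (X *m _) - _](upper_lower (X *m cornerG)) mulmxDl mxtraceD.
have -> : \tr (upper_part (gamma_plus (X *m cornerG)) *m (X *m GY')) =
          \tr (upper_part (X *m cornerG) *m gamma_minus (X *m GY')).
  rewrite upper_gamma_plus /gamma_plus /gamma_minus -!mulmxA.
  by rewrite mxtrace_mulC -!mulmxA.
have := trace_upper_upper (X *m cornerG) (gradR_lower gG).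
rewrite /gradR mulmxDr mxtraceD => upE.
by rewrite opprD addrCA subrr addr0 -opprD upE oppr0.
Qed.

End PrincipalMinor.

(** * The bracket on pairs of members of the family *)

Section LogCanonical.

Variables (F : fieldType) (n : nat).
Hypothesis n_gt1 : (1 < n)%N.
Implicit Types (f g : {mpoly F[n * n]}) (X : 'M[F]_n).

Definition log_bracket f g : Prop :=
  exists omega : F, forall X, CG_bracket f g X = omega * (evalf f X * evalf g X).

Lemma log_bracket_sym f g : log_bracket f g -> log_bracket g f.
Proof.
case=> omega fgE; exists (- omega) => X.
by rewrite CG_bracket_skew fgE; ring.
Qed.

Definition graded_poly f (GX GY : 'M[F]_n -> 'M[F]_n) (c : weights F n) : Prop :=
  forall X, grad f X = GX X + GY X /\ graded_at c X (GX X) (GY X) (evalf f X).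

Lemma log_bracket_graded f g GX GY GX' GY' c c' (omega : F) :
  graded_poly f GX GY c -> graded_poly g GX' GY' c' ->
  (forall X, bracket_rest X (GX X) (GY X) (GX' X) (GY' X) =
     omega * (evalf f X * evalf g X)) ->
  log_bracket f g.
Proof.
move=> fG gG restE; exists (omega + weights_coef c c') => X.
have [fE fGX] := fG X; have [gE gGX] := gG X.
by rewrite (CG_bracket_graded fE gE fGX gGX) restE; ring.
Qed.

Lemma evalf_det i (M : 'M[{mpoly F[n * n]}]_i) X :
  evalf (\det M) X = \det (map_mx (evalm X) M).
Proof. by rewrite det_map_mx. Qed.

Lemma graded_theta i : (i <= n)%N ->
  graded_poly (theta F n i) (fun X => cornerG (n - i) i X) (fun=> 0)
    (corner_weights F n (n - i) i).
Proof.
move=> le_in X.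
have MX : map_mx (evalm X)
    (subblock (genmat F n) (n - i).+1 (n - i).+1 : 'M_i) =
    window (entry X) (n - i) (n - i) i.
  by apply/matrixP => r s; rewrite !mxE eval_entry_genmat.
split; last by rewrite evalf_det MX; apply: graded_corner; rewrite subnK.
rewrite addr0; apply/matrixP => j l; rewrite grad_det MX mxE.
apply: eq_bigr => s _; apply: eq_bigr => r _.
by congr (_ * _); rewrite mxE deriv_entry_genmat.
Qed.

(** Common form of [phi] and [psi], which differ only by a column offset [eps] of 0 or 1. *)
Definition band_minor (p q i : nat) : {mpoly F[n * n]} :=
  \det (\matrix_(r < i, s < i) cgU n (entry (genmat F n)) (p + r) (q + s)).

Lemma graded_band_minor p q i L eps : (eps <= 1)%N ->
  (p + i = L * n.-1)%N -> (q + i = L * n.+1 + eps)%N ->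
  (forall X, evalf (band_minor p q i) X = \det (window (cgU n (entry X)) p q i)) /\
  graded_poly (band_minor p q i) (fun X => minorX X p q i)
    (fun X => minorY X p q i) (minor_weights F n p q i).
Proof.
move=> eps_le1 row_end col_end.
have MX X : map_mx (evalm X)
    (\matrix_(r < i, s < i) cgU n (entry (genmat F n)) (p + r) (q + s)) =
    window (cgU n (entry X)) p q i.
  apply/matrixP => r s; rewrite !mxE /cgU /cgX /cgY rmorphD !rmorphM !rmorph_nat.
  by rewrite /= !eval_entry_genmat.
have fE X : evalf (band_minor p q i) X = \det (window (cgU n (entry X)) p q i).
  by rewrite evalf_det MX.
split=> // X; split; last by rewrite fE; apply: graded_minor row_end col_end _.
apply/matrixP => j l; rewrite grad_det MX !mxE -big_split; apply: eq_bigr => s _.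
rewrite -big_split; apply: eq_bigr => r _ /=; rewrite -mulrDr; congr (_ * _); rewrite mxE.
have natE (b : bool) (h : {mpoly F[n * n]}) v :
    (b%:R * h)^`M(v) = b%:R * h^`M(v).
  by rewrite !mulr_natl mderivMn.
rewrite /cgU /cgX /cgY mderivD !natE rmorphD !rmorphM !rmorph_nat.
by rewrite /= !deriv_entry_genmat.
Qed.

Local Notation k := (CG_k n).
Local Notation N := (CG_N n).

Lemma CG_N_bound i : (i <= N)%N -> (i <= k * n.+1)%N.
Proof.
move=> le_i; apply: leq_trans le_i _; rewrite /CG_N leq_mul2l.
by apply/orP; right; lia.
Qed.

Lemma log_bracket_bands i i' eps eps' :
  (eps <= 1)%N -> (eps' <= 1)%N -> (i <= N)%N -> (i' <= i)%N ->
  log_bracket (band_minor (N - i) (k * n.+1 + eps - i) i)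
              (band_minor (N - i') (k * n.+1 + eps' - i') i').
Proof.
move=> le_e le_e' le_iN le_i'i; have le_i := CG_N_bound le_iN.
have row' : (N - i' + i' = k * n.-1)%N by rewrite subnK // (leq_trans le_i'i).
have col' : (k * n.+1 + eps' - i' + i' = k * n.+1 + eps')%N by lia.
have row0 : (N - i + i = k * n.-1)%N by rewrite subnK.
have col0 : (k * n.+1 + eps - i + i = k * n.+1 + eps)%N by lia.
have row2 : (N - i + k * n.-1 + i = k.*2 * n.-1)%N.
  by rewrite addnAC row0 -mulnDl addnn.
have col2 : (k * n.+1 + eps - i + k * n.+1 + i = k.*2 * n.+1 + eps)%N.
  by rewrite addnAC col0 addnAC -mulnDl addnn.
have [fE fG] := graded_band_minor le_e row0 col0.
have [gE gG] := graded_band_minor le_e' row' col'.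
apply: (log_bracket_graded fG gG) => X /=.
have [sX sY] := shift_minor X (N - i) (k * n.+1 + eps - i) i k n_gt1.
rewrite -sX -sY (bracket_rest_minors n_gt1 le_e le_e' row2 col2 row' col') //.
- by rewrite shift_window // fE gE.
- exact: leq_addl.
- exact: leq_addl.
Qed.

Lemma phiE i : (i <= N)%N ->
  phi F n i = band_minor (N - i) (k * n.+1 + 0 - i) i.
Proof.
move=> le_iN; have le_i := CG_N_bound le_iN; rewrite addn0.
congr (\det _); apply/matrixP => r s; rewrite !mxE !succnK entry_matU //.
  by have := ltn_ord r; rewrite /CG_N in le_iN *; lia.
by have := ltn_ord s; rewrite mulSn; lia.
Qed.

Lemma psiE i : (i <= N)%N ->
  psi F n i = band_minor (N - i) (k * n.+1 + 1 - i) i.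
Proof.
move=> le_iN; have le_i := CG_N_bound le_iN; rewrite addn1 subSn //.
congr (\det _); apply/matrixP => r s; rewrite !mxE !succnK entry_matU //.
  by have := ltn_ord r; rewrite /CG_N in le_iN *; lia.
by have := ltn_ord s; rewrite mulSn; lia.
Qed.

Lemma CG_M_le : (CG_M n <= N)%N.
Proof.
rewrite /CG_M; case: ifP => // n_odd; rewrite /CG_N /CG_k.
(* With truncated subtraction, [(N - n).+1] is at most [N] once [N] is positive. *)
have : (0 < n.+1./2 * n.-1)%N by rewrite muln_gt0 half_gt0; lia.
by lia.
Qed.

Lemma CG_familyP f : CG_family f ->
  (exists2 i, (i <= n)%N & f = theta F n i) \/
  (exists i eps, [/\ (i <= N)%N, (eps <= 1)%N
     & f = band_minor (N - i) (k * n.+1 + eps - i) i]).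
Proof.
case=> [[i /andP[_ le_i] ->]|[i /andP[_ le_i] ->]|[i /andP[_ le_i] ->]].
- by left; exists i => //; lia.
- by right; exists i, 0%N; split=> //; apply: phiE.
- have le_iN := leq_trans le_i CG_M_le.
  by right; exists i, 1%N; split=> //; apply: psiE.
Qed.

Lemma CG_family_graded f : CG_family f -> exists GX GY c, graded_poly f GX GY c.
Proof.
case/CG_familyP=> [[i le_i ->]|[i [eps [le_iN le_e ->]]]].
  by do 3!eexists; apply: graded_theta.
have le_i := CG_N_bound le_iN.
have row0 : (N - i + i = k * n.-1)%N by rewrite subnK.
have col0 : (k * n.+1 + eps - i + i = k * n.+1 + eps)%N by lia.
by have [_ fG] := graded_band_minor le_e row0 col0; do 3!eexists; apply: fG.
Qed.

Lemma log_bracket_theta i g : (i <= n)%N -> CG_family g ->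
  log_bracket (theta F n i) g.
Proof.
move=> le_i /CG_family_graded[GX [GY [c gG]]].
(* Here 0 is the share of the three traces; the constant of the bracket is then [weights_coef]. *)
apply: (log_bracket_graded (omega := 0) (graded_theta le_i) gG) => X.
by rewrite mul0r; apply: bracket_rest_corner (proj2 (gG X)); rewrite subnK.
Qed.

Lemma log_bracket_family f g : CG_family f -> CG_family g -> log_bracket f g.
Proof.
move=> fF gF; case/CG_familyP: (fF) => [[i le_i ->]|[i [eps [le_i le_e fE]]]].
  exact: log_bracket_theta.
case/CG_familyP: (gF) => [[i' le_i' ->]|[i' [eps' [le_i' le_e' gE]]]].
  exact/log_bracket_sym/log_bracket_theta.
rewrite fE gE; have [le_ii|/ltnW le_ii] := leqP i' i.
  exact: log_bracket_bands.
exact/log_bracket_sym/log_bracket_bands.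
Qed.

End LogCanonical.

Theorem theorem3p3 (F : fieldType) (n : nat) :
  [pchar F] =i pred0 -> (2 <= n)%N ->
  log_canonical_SL (@CG_family F n).
Proof.
move=> _ n_gt1 f g fF gF.
by have [omega fgE] := log_bracket_family n_gt1 fF gF; exists omega => X _.
Qed.
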